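(* Let $n,k$ be natural numbers with $2\leq k\leq n$ and let $q\in[1,\infty)$. Let $X_1,\dots,X_n,Y$ be Banach spaces over $\mathbb{K}$ such that $X_j$ has finite cotype $s_j\geq 2$ for $j=1,\dots,k$, and suppose that $$1\leq \frac1{s_1}+\cdots+\frac1{s_k}.$$ Let $p,r$ be real numbers satisfying $$1\leq r<p<\min_{1\leq j\leq k}s_j^{\ast}\quad\text{if } s_j\neq 2\text{ for some } j=1,\dots,k,$$ $$1\leq r<p\leq 2\quad\text{if } s_j=2\text{ for all } j=1,\dots,k.$$ Then $$\Pi^{n}_{p;p_1,\dots,p_k,q,\dots,q}(X_1,\dots,X_n;Y)\subseteq\Pi^{n}_{r;r_1,\dots,r_k,q,\dots,q}(X_1,\dots,X_n;Y),$$ where $p_j=p$ and $r_j=r$ for all $j=1,\dots,k$, and $q$ is repeated $n-k$ times. In particular, for all such $p$ and $r$, $$\Pi^{n}_{p;p}(X_1,\dots,X_n;Y)\subseteq\Pi^{n}_{r;r}(X_1,\dots,X_n;Y).$$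
   Context: All Banach spaces are over $\mathbb{K}=\mathbb{R}$ or $\mathbb{C}$. $\mathcal{L}(X_1,\dots,X_n;Y)$ denotes the space of continuous $n$-linear operators from $X_1\times\cdots\times X_n$ to $Y$. For $1\leq s<\infty$, $s^{\ast}$ is the conjugate exponent of $s$ ($1/s+1/s^{\ast}=1$). For $1\leq q<\infty$, $\ell_q^w(X)$ is the set of sequences $(x_j)_{j=1}^\infty\subset X$ with $\sup_{\varphi\in B_{X^*}}\sum_j|\varphi(x_j)|^q<\infty$. $\ell_p(Y)$ is the space of sequences $(y_j)$ in $Y$ with $\sum_j\|y_j\|^p<\infty$. For $0<p,q_1,\dots,q_n<\infty$ with $\frac1p\leq\frac1{q_1}+\cdots+\frac1{q_n}$, an operator $T\in\mathcal{L}(X_1,\dots,X_n;Y)$ is absolutely $(p;q_1,\dots,q_n)$-summing if $(T(x_j^{(1)},\dots,x_j^{(n)}))_{j=1}^\infty\in\ell_p(Y)$ whenever $(x_j^{(k)})_{j=1}^\infty\in\ell_{q_k}^w(X_k)$ for $k=1,\dots,n$. The class of all such $T$ is denoted $\Pi^n_{p;q_1,\dots,q_n}(X_1,\dots,X_n;Y)$; when $q_1=\cdots=q_n=q$ it is written $\Pi^n_{p;q}(X_1,\dots,X_n;Y)$. *)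

(* Defs.v *)
From HB Require Import structures.
From mathcomp Require Import all_boot all_order all_algebra.
From mathcomp Require Import all_classical all_reals all_analysis.
From mathcomp Require Import complex.

Set Implicit Arguments.
Unset Strict Implicit.
Unset Printing Implicit Defensive.

Import Order.TTheory GRing.Theory Num.Theory.
Import numFieldNormedType.Exports.

Local Open Scope classical_set_scope.
Local Open Scope ring_scope.

Variant scalar_kind := RealScalars | ComplexScalars.

Definition scalars (R : realType) (b : scalar_kind) : numFieldType :=
  match b with
  | RealScalars => R : numFieldType
  | ComplexScalars => R[i] : numFieldType
  end.

Definition re_scalar (R : realType) (b : scalar_kind) : scalars R b -> R :=
  match b return scalars R b -> R with
  | RealScalars => fun x => x
  | ComplexScalars => fun z => complex.Re z
  end.

(* The norm of a normedModType over K takes values in K (in R[i] when the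
   scalars are complex), where it is real and nonnegative; [rnorm] is the same
   norm seen as an element of R. *)
Definition rnorm (R : realType) (b : scalar_kind)
    (V : normedModType (scalars R b)) (x : V) : R :=
  re_scalar `|x|.

Section SummingOperators.
Context {R : realType} {b : scalar_kind}.
Local Notation K := (scalars R b).

Definition dual_unit_ball (X : normedModType K) : set (X -> K^o) :=
  [set phi : X -> K^o | [/\ scalar phi, continuous phi &
     forall x : X, rnorm x <= 1 -> rnorm (phi x) <= 1]].

Definition weakly_summable (X : normedModType K) (q : R) (x : nat -> X) :=
  (ereal_sup [set (\sum_(0 <= j <oo) (rnorm (phi (x j)) `^ q)%:E)%E
             | phi in @dual_unit_ball X] < +oo)%E.

Definition strongly_summable (Y : normedModType K) (p : R) (y : nat -> Y) :=
  (\sum_(0 <= j <oo) (rnorm (y j) `^ p)%:E < +oo)%E.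

(* Cotype s, with L^2 Rademacher averages.  The Rademacher average of finitely
   many vectors is the uniform average over all 2 ^ m choices of signs. *)
Definition has_cotype (X : normedModType K) (s : R) :=
  exists C : R, forall (m : nat) (x : 'I_m -> X),
    (\sum_(j < m) rnorm (x j) `^ s) `^ s^-1 <=
    C * Num.sqrt ((2 ^+ m)^-1 *
          \sum_(eps : {ffun 'I_m -> bool})
             rnorm (\sum_(j < m) (-1) ^+ eps j *: x j) ^+ 2).

Section Multilinear.
Context {n : nat} (X : 'I_n -> completeNormedModType K)
  (Y : completeNormedModType K).

Definition multilinear (T : (forall i, X i) -> Y) :=
  forall (i : 'I_n) (x : forall i, X i),
    linear (fun u : X i => T (dfwith x i u)).

Definition continuous_multilinear : set (prod_topology X -> Y) :=
  [set T : prod_topology X -> Y | multilinear T /\ continuous T].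

(* Meaningful for 0 < p, q_i with 1/p <= sum_i 1/q_i (otherwise only T = 0
   can be a member), and for 1 <= q_i as in the definition of weakly
   q_i-summable sequences. *)
Definition summing (p : R) (q : 'I_n -> R) : set (prod_topology X -> Y) :=
  [set T : prod_topology X -> Y | continuous_multilinear T /\
    forall x : forall i : 'I_n, nat -> X i,
      (forall i, weakly_summable (q i) (x i)) ->
      strongly_summable p (fun j => T (fun i => x i j))].

End Multilinear.
End SummingOperators.

(* Main.v *)
Require Import Defs.
From HB Require Import structures.
From mathcomp Require Import all_boot all_order all_algebra.
From mathcomp Require Import all_classical all_reals all_analysis.
From mathcomp Require Import complex.
From mathcomp Require Import ring lra.

Set Implicit Arguments.
Unset Strict Implicit.
Unset Printing Implicit Defensive.

Import Order.TTheory GRing.Theory Num.Theory.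
Import numFieldNormedType.Exports.

Local Open Scope classical_set_scope.
Local Open Scope ring_scope.

(** The inclusion comes from a factorization of weakly summable sequences in one
    coordinate.  Let [X i0] have cotype [s], and let [p] be smaller than the
    conjugate exponent of [s], or [p = s = 2].  Then a weakly r-summable
    sequence [x] of [X i0] can be multiplied by large scalars [a j] and become
    weakly p-summable; the gain is the one predicted by
    [l_r^w = l_u * l_p^w] with [1/u = 1/r - 1/p].  If [T] is p-summing and the
    norms [c j] of the values of [T] along given sequences were not in [l_r],
    the scalars could be chosen, depending on [c], so that [(a j * c j)] is
    not in [l_p]; as [T] is linear in the coordinate [i0], this contradicts
    p-summability ([summing_inclusion]).

    The scalars are found on finite sets of indices, with a constant that does
    not depend on their size, and then glued ([glue_weights]).  For finitely
    many vectors with bounded weak 1-norm, the seminorm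
    [F g = |sum_j g j x j|] on real sequences is at most a constant times the
    supremum norm.  What is needed is a domination of [F] by a weighted [l_t]
    norm, [t] being the exponent conjugate to [p]: by duality, the weights turn
    [x] into a weakly p-summable sequence ([dual_weighted_sum]).  Cotype [s]
    makes [F] summing of type [(s, 1)], and the weights are produced by
    Pisier's extremal argument ([pietsch_weights]) followed by interpolation
    between [l_1] and the supremum norm ([dyadic_bound]); this requires [s < t].
    At the endpoint [s = t = 2] the domination by a weighted [l_4] norm is
    upgraded by means of Khintchine's inequality and a second use of the
    extremal argument ([cotype2_weights]).  The case of a weak r-norm reduces
    to the case [r = 1] by multiplying [x] with a norming element of the dual
    of [l_r] ([rescale_weakly_summable_fin]).

    The Hahn-Banach theorem enters twice: it gives the subgradients of [F] in
    the extremal argument, and functionals that norm the vectors of [X i0], on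
    which the weak norms rest. *)

(** * The Hahn-Banach theorem *)

Definition sublinear (R : realType) (V : lmodType R) (p : V -> R) :=
  (forall x y, p (x + y) <= p x + p y) /\
  (forall t x, 0 <= t -> p (t *: x) = t * p x).

Lemma sublinear_ge_oppN (R : realType) (V : lmodType R) (p : V -> R) x :
  sublinear p -> - p (- x) <= p x.
Proof.
move=> [pD pZ]; have := pD x (- x); rewrite subrr.
have -> : p 0 = 0 by rewrite -(scale0r 0) pZ// mul0r.
by rewrite -lerBlDr sub0r.
Qed.

(** Zorn's lemma below [p]: the pointwise infimum of a chain of sublinear
    functions is sublinear, and it is finite because a sublinear [q] below [p]
    satisfies [- p (- x) <= - q (- x) <= q x]. *)
Lemma minimal_sublinear (R : realType) (V : lmodType R) (p : V -> R) :
  sublinear p ->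
  exists q : V -> R, [/\ sublinear q, forall x, q x <= p x &
    forall q' : V -> R, sublinear q' -> (forall x, q' x <= q x) ->
      forall x, q x <= q' x].
Proof.
move=> sp.
pose P (q : V -> R) := sublinear q /\ forall x, q x <= p x.
pose T := {q : V -> R | P q}.
have Tsub (s : T) : sublinear (sval s) by case: s => s [].
pose le_ (s t : T) := `[< forall x, sval t x <= sval s x >].
have pT : P p by split.
have [||A Atot|[q [sq qp]] qmin] := @ZL_preorder T (exist P p pT) le_.
- by move=> t; apply/asboolP.
- move=> r s t /asboolP rs /asboolP st; apply/asboolP => x.
  exact: le_trans (st x) (rs x).
- have [->|/set0P[q0 Aq0]] := eqVneq A set0.
    by exists (exist P p pT) => s.
  pose E x : set R := [set sval s x | s in A].
  have E0 x : E x !=set0 by exists (sval q0 x); exists q0.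
  have Elb x : lbound (E x) (- p (- x)).
    move=> _ [[s [ss sp']] As <-] /=.
    by apply: le_trans (sublinear_ge_oppN x ss); rewrite lerN2.
  have infE s x : A s -> inf (E x) <= sval s x.
    by move=> As; apply: ge_inf; [exists (- p (- x)); exact: Elb|exists s].
  have sinf : sublinear (fun x => inf (E x)) /\ forall x, inf (E x) <= p x.
    split; last first.
      by move=> x; apply: le_trans (infE _ _ Aq0) _; case: (q0) => /= ? [].
    split=> [x y|t x t0].
      rewrite -lerBlDl; apply: lb_le_inf => // _ [s As <-].
      rewrite lerBlDl -lerBlDr; apply: lb_le_inf => // _ [s' As' <-].
      rewrite lerBlDr.
      (* along a chain, the smaller of two sublinear functions serves both *)
      have [r [Ar rs rs']] : exists r, [/\ A r, (forall z, sval r z <= sval s z)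
                                    & (forall z, sval r z <= sval s' z)].
        by have [/asboolP ss'|/asboolP ss'] := Atot _ _ As As'; [exists s'|exists s].
      apply: le_trans (infE _ _ Ar) _.
      have [rD _] := Tsub r.
      by apply: le_trans (rD x y) _; apply: lerD.
    have sZ (s : T) : sval s (t *: x) = t * sval s x.
      by have [_ rZ] := Tsub s; rewrite rZ.
    move: t0; rewrite le_eqVlt => /predU1P[t0|t0].
      apply/eqP; rewrite -t0 mul0r eq_le; apply/andP; split.
        by apply: le_trans (infE _ _ Aq0) _; rewrite t0 sZ -t0 mul0r.
      by apply: lb_le_inf => // _ [s As <-]; rewrite t0 sZ -t0 mul0r.
    apply/eqP; rewrite eq_le; apply/andP; split.
      rewrite -ler_pdivrMl//; apply: lb_le_inf => // _ [s As <-].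
      by rewrite ler_pdivrMl// -sZ; exact: infE.
    apply: lb_le_inf => // _ [s As <-].
    by rewrite sZ ler_pM2l//; exact: infE.
  exists (exist P _ sinf) => s As; apply/asboolP => x /=; exact: infE.
exists q; split => // q' sq' q'q x.
have q'p : sublinear q' /\ forall x, q' x <= p x.
  by split=> // z; exact: le_trans (q'q z) (qp z).
have := qmin (exist P q' q'p) => /(_ _)/asboolP; apply; apply/asboolP; exact: q'q.
Qed.

(** The infimum over [t >= 0] of [p (y + t x) - t p x] replaces [p] by its slope
    in the direction [x]: [t = 0] gives the first bound and [t = 1] the second.
    Applied to a minimal sublinear function it forces additivity, and applied
    to [p] itself, at [y = - x], it pins down the value at [x]. *)
Lemma sublinear_steepest (R : realType) (V : lmodType R) (p : V -> R) (x : V) :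
  sublinear p ->
  exists q : V -> R, [/\ sublinear q, forall y, q y <= p y &
    forall y, q y <= p (y + x) - p x].
Proof.
move=> [pD pZ].
have p0 : p 0 = 0 by rewrite -(scale0r 0) pZ// mul0r.
pose E y : set R := [set p (y + t *: x) - t * p x | t in [set t : R | 0 <= t]].
have E0 z : E z !=set0 by exists (p (z + 0 *: x) - 0 * p x); exists 0 => //=.
have Elb z : lbound (E z) (- p (- z)).
  move=> _ [t /= t0 <-]; rewrite -pZ// lerBrDr addrC lerBlDl.
  by rewrite -{1}(addKr z (t *: x)); exact: pD.
have infE z t : 0 <= t -> inf (E z) <= p (z + t *: x) - t * p x.
  by move=> t0; apply: ge_inf; [exists (- p (- z)); exact: Elb|exists t].
have infp z : inf (E z) <= p z.
  by apply: le_trans (infE z 0 _) _ => //; rewrite scale0r mul0r addr0 subr0.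
exists (fun z => inf (E z)); split=> // [|y]; last first.
  by have := infE y 1 ler01; rewrite scale1r mul1r.
split=> [z z'|s z].
  rewrite -lerBlDl; apply: lb_le_inf => // _ [t /= t0 <-].
  rewrite lerBlDl -lerBlDr; apply: lb_le_inf => // _ [t' /= t0' <-].
  rewrite lerBlDr; apply: le_trans (infE _ (t' + t) _) _.
    exact: addr_ge0.
  rewrite scalerDl addrACA mulrDl.
  have := pD (z + t' *: x) (z' + t *: x); lra.
rewrite le_eqVlt => /predU1P[<-|s0].
  rewrite scale0r mul0r; apply/eqP; rewrite eq_le; apply/andP; split.
    by rewrite -[leRHS]p0; exact: infp.
  by apply: lb_le_inf => // _ [t /= t0 <-]; rewrite add0r pZ// subrr.
apply/eqP; rewrite eq_le; apply/andP; split.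
  rewrite -ler_pdivrMl//; apply: lb_le_inf => // _ [t /= t0 <-].
  rewrite ler_pdivrMl// mulrBr -pZ ?(ltW s0)// scalerDr scalerA mulrA.
  by apply: infE; rewrite mulr_ge0// ltW.
apply: lb_le_inf => // _ [t /= t0 <-].
rewrite -ler_pdivlMl// mulrBr -pZ ?invr_ge0 ?(ltW s0)// scalerDr !scalerA mulrA.
rewrite mulVf ?gt_eqF// scale1r.
by apply: infE; rewrite mulr_ge0// invr_ge0 ltW.
Qed.

(** A minimal sublinear function coincides with all its steepest minorants,
    hence is additive.  Minimizing below the steepest minorant of [p] in the
    direction [x0] makes the resulting linear function agree with [p] at
    [x0]. *)
Lemma hahn_banach_sublinear (R : realType) (V : lmodType R) (p : V -> R) (x0 : V) :
  sublinear p ->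
  exists q : V -> R, [/\ forall x y, q (x + y) = q x + q y,
    forall t x, q (t *: x) = t * q x, forall x, q x <= p x & q x0 = p x0].
Proof.
move=> sp; have [p' [sp' p'p p'x0]] := sublinear_steepest x0 sp.
have [q [sq qp' qmin]] := minimal_sublinear sp'; have [qD qZ] := sq.
have qp x : q x <= p x by exact: le_trans (qp' x) (p'p x).
have q0 : q 0 = 0 by rewrite -(scale0r 0) qZ// mul0r.
have addq x y : q y + q x <= q (y + x).
  have [q' [sq' q'q q'x]] := sublinear_steepest x sq.
  by rewrite -lerBrDr; apply: le_trans (q'x y); exact: (qmin _ sq').
have qD' x y : q (x + y) = q x + q y by apply/eqP; rewrite eq_le qD addq.
have qN z : q (- z) = - q z.
  by apply/eqP; rewrite -subr_eq0 opprK -qD' addNr q0.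
exists q; split=> // [t x|].
  have [t0|t0] := leP 0 t; first exact: qZ.
  apply: oppr_inj; rewrite -qN -scaleNr -mulNr.
  by apply: qZ; rewrite oppr_ge0 ltW.
apply/eqP; rewrite eq_le qp -lerN2 -qN; apply: le_trans (qp' _) _.
apply: le_trans (p'x0 _) _; have [_ pZ] := sp.
by rewrite addNr -(scale0r 0) pZ// mul0r sub0r.
Qed.

(** * Seminorms on finite sequences *)

Definition seminorm (R : realType) (V : lmodType R) (F : V -> R) :=
  (forall x y, F (x + y) <= F x + F y) /\ (forall t x, F (t *: x) = `|t| * F x).

Section SeminormTheory.
Context (R : realType) (V : lmodType R) (F : V -> R).
Hypothesis sF : seminorm F.

Lemma seminorm0 : F 0 = 0.
Proof. by case: sF => _ FZ; rewrite -(scale0r 0) FZ normr0 mul0r. Qed.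

Lemma seminorm_ge0 x : 0 <= F x.
Proof.
case: sF => FD FZ; have := FD x (- x); rewrite subrr seminorm0.
rewrite -scaleN1r FZ normrN1 mul1r; lra.
Qed.

Lemma seminorm_sublinear : sublinear F.
Proof. by case: sF => FD FZ; split=> // t x t0; rewrite FZ ger0_norm. Qed.

End SeminormTheory.

Lemma scale_funE (R : realType) (I : Type) (t : R) (g : I -> R) i :
  (t *: g) i = t * g i.
Proof. by []. Qed.

Lemma sum_delta (R : realType) N (h : 'I_N -> R) :
  h = \sum_j h j *: (fun i => (i == j)%:R).
Proof.
rewrite fct_sumE; apply/funext => i; rewrite (bigD1 i)//= big1 => [|j ji].
  by rewrite addr0 scale_funE eqxx mulr1.
by rewrite scale_funE eq_sym (negbTE ji) mulr0.
Qed.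

Lemma seminorm_subgradient (R : realType) N (F : ('I_N -> R) -> R) (f : 'I_N -> R) :
  seminorm F ->
  exists z : 'I_N -> R, (forall h, \sum_j z j * h j <= F h) /\
    \sum_j z j * f j = F f.
Proof.
move=> /seminorm_sublinear sF.
have [q [qD qZ qF qf]] := hahn_banach_sublinear f sF.
have q0 : q 0 = 0 by rewrite -(scale0r 0) qZ mul0r.
exists (fun j => q (fun i => (i == j)%:R)).
suff qE h : \sum_j q (fun i => (i == j)%:R) * h j = q h by split=> [h|]; rewrite qE.
rewrite [in RHS](sum_delta h) (big_morph q qD q0).
by apply: eq_bigr => j _; rewrite qZ mulrC.
Qed.

(** Convexity of [x ^ r]: the graph lies above its tangent at [a]. *)
Lemma young_tangent (R : realType) (r a b : R) : 1 <= r -> 0 <= a -> 0 <= b ->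
  r * (a `^ (r - 1) * b) <= (r - 1) * a `^ r + b `^ r.
Proof.
rewrite le_eqVlt => /predU1P[<- a0 b0|r1 a0 b0].
  by rewrite subrr powRr0 !mul1r mul0r add0r powRr1.
have r0 : 0 < r by lra.
have r10 : 0 < r - 1 by lra.
have := @conjugate_powR R (a `^ (r - 1)) b (r / (r - 1)) r (powR_ge0 _ _) b0.
rewrite divr_gt0// => /(_ erefl r0) H.
have {H} := H ltac:(by field; rewrite !gt_eqF).
rewrite -powRrM mulrCA mulfV ?gt_eqF// mulr1.
rewrite -(ler_pM2l r0) => /le_trans; apply.
by rewrite le_eqVlt; apply/orP; left; apply/eqP; field; rewrite !gt_eqF.
Qed.

Lemma powR_le1 (R : realType) (x y : R) : 0 <= x <= 1 -> 0 <= y -> x `^ y <= 1.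
Proof.
move=> /andP[x0 x1] y0; apply: (@le_trans _ _ (1 `^ y)); last by rewrite powR1.
by apply: ge0_ler_powR; rewrite ?nnegrE.
Qed.

(** Pisier's extremal argument.  Take a family [f] whose sum [S] is within
    [e] of the supremum, and let [L] be the linear form on sequences obtained
    by adding the subgradients of [F] at the [f i], weighted by
    [F (f i) ^ (s - 1)]; thus [L 1 = S].  If [|g| <= 1], damping [f] by
    [w = (1 - |g| ^ a) ^ (1 / a)] leaves room for [g] in the family, so
    [F g ^ s] is at most [e] plus the loss caused by the damping; by convexity
    this loss is at most [s * L (1 - w)], and [1 - w <= |g| ^ a].  The weights
    are the absolute values of the coefficients of [s * L], plus [e] at each
    point. *)
Lemma pietsch_weights (R : realType) N (F : ('I_N -> R) -> R) (a s K : R) :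
  seminorm F -> 1 <= a -> a <= s ->
  (forall m (f : 'I_m -> 'I_N -> R), (forall j, \sum_i `|f i j| `^ a <= 1) ->
     \sum_i F (f i) `^ s <= K) ->
  exists lam : 'I_N -> R, [/\ forall j, 0 < lam j, \sum_j lam j <= s * K + 1 &
    forall g, (forall j, `|g j| <= 1) -> F g `^ s <= \sum_j lam j * `|g j| `^ a].
Proof.
move=> sF a1 as_ FK; have [FD FZ] := sF; have F0 := seminorm_ge0 sF.
have s1 : 1 <= s by exact: le_trans as_.
have a0 : 0 < a by lra.
have s0 : 0 < s by lra.
pose adm m (f : 'I_m -> 'I_N -> R) := forall j, \sum_i `|f i j| `^ a <= 1.
pose A : set R := [set v | exists m (f : 'I_m -> 'I_N -> R),
                             adm m f /\ v = \sum_i F (f i) `^ s].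
have ubA : ubound A K by move=> _ [m [f [af ->]]]; exact: FK.
have supA : has_sup A.
  split; last by exists K.
  exists 0, 0, (fun=> 0); split; last by rewrite big_ord0.
  by move=> j; rewrite big_ord0.
(* e is small enough for N copies of it to add at most 1 to the total weight *)
pose e : R := N.+1%:R^-1.
have e0 : 0 < e by rewrite invr_gt0.
have [_ [m [f [af ->]]] ltS] := sup_adherent e0 supA.
set S := \sum_i F (f i) `^ s in ltS.
have SK : S <= K by exact: FK.
have [z zF] := choice (fun i => seminorm_subgradient (f i) sF).
pose L j := \sum_i F (f i) `^ (s - 1) * (z i j * f i j).
have LE w : \sum_j L j * w j =
    \sum_i F (f i) `^ (s - 1) * \sum_j z i j * (f i j * w j).
  rewrite /L; under eq_bigr do rewrite mulr_suml.
  rewrite exchange_big; apply: eq_bigr => i _; rewrite mulr_sumr.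
  by apply: eq_bigr => j _; rewrite -!mulrA.
have Lle w : s * \sum_j L j * w j <= (s - 1) * S + \sum_i F (f i * w) `^ s.
  rewrite LE !mulr_sumr -big_split /=; apply: ler_sum => i _.
  apply: le_trans (young_tangent s1 (F0 _) (F0 _)).
  rewrite ler_pM2l// ler_wpM2l ?powR_ge0//.
  by have [+ _] := zF i => /(_ (f i * w)).
have LS : \sum_j L j = S.
  have := LE (fun=> 1); under eq_bigr do rewrite mulr1.
  move=> ->; apply: eq_bigr => i _.
  under eq_bigr do rewrite mulr1.
  by have [_ ->] := zF i; rewrite mulrC mulr_powRB1.
have admw w : (forall j, 0 <= w j) -> forall j, \sum_i `|f i j * w j| `^ a <= w j `^ a.
  move=> w0 j; under eq_bigr do rewrite normrM powRM// (ger0_norm (w0 j)).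
  by rewrite -mulr_suml ler_piMl ?powR_ge0.
have sumL : s * \sum_j `|L j| <= s * K.
  have -> : \sum_j `|L j| = \sum_j L j * Num.sg (L j).
    by apply: eq_bigr => j _; rewrite mulrC -normrEsg.
  apply: le_trans (Lle _) _.
  have : \sum_i F (f i * (fun j => Num.sg (L j))) `^ s <= K.
    apply: FK => j; apply: le_trans (af j); apply: ler_sum => i _.
    apply: ge0_ler_powR; rewrite ?nnegrE ?(ltW a0)// normrM.
    by rewrite ler_piMr// normr_sg; case: (_ == _).
  by have : (s - 1) * S <= (s - 1) * K; [rewrite ler_wpM2l// subr_ge0|lra].
have Fg g : (forall j, `|g j| <= 1) -> F g `^ s <= e + s * \sum_j `|L j| * `|g j| `^ a.
  move=> g1.
  pose u j := 1 - `|g j| `^ a.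
  have u0 j : 0 <= u j by rewrite subr_ge0 powR_le1 ?normr_ge0 ?g1 ?ltW.
  have u1 j : u j <= 1 by rewrite lerBlDr lerDl powR_ge0.
  pose w j := u j `^ a^-1.
  have w0 j : 0 <= w j by exact: powR_ge0.
  have wa j : w j `^ a = u j by rewrite -powRrM mulVf ?gt_eqF// powRr1.
  have w1 j : w j <= 1 by rewrite powR_le1 ?u0 ?u1// invr_ge0 ltW.
  have uw j : u j <= w j.
    have := u0 j; rewrite le_eqVlt => /predU1P[<-|u0'] //.
    by apply: ger1_powR; rewrite ?u0' ?u1// invf_le1.
  pose f' (i : 'I_m.+1) := if unlift ord0 i is Some i' then f i' * w else g.
  have f'0 : f' ord0 = g by rewrite /f' unlift_none.
  have f'S i : f' (lift ord0 i) = f i * w by rewrite /f' liftK.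
  have : \sum_i F (f' i) `^ s <= sup A.
    apply: ub_le_sup; first by exists K.
    exists m.+1, f'; split=> // j; rewrite big_ord_recl f'0.
    under eq_bigr do rewrite f'S.
    have := admw _ w0 j; rewrite wa /u => H.
    by rewrite -lerBrDl.
  rewrite big_ord_recl f'0; under eq_bigr do rewrite f'S.
  have := Lle w.
  have : s * \sum_j L j - s * \sum_j L j * w j <= s * \sum_j `|L j| * `|g j| `^ a.
    rewrite -mulrBr ler_pM2l// -sumrB; apply: ler_sum => j _.
    rewrite -{1}(mulr1 (L j)) -mulrBr; apply: le_trans (ler_norm _) _.
    rewrite normrM ler_wpM2l// ger0_norm ?subr_ge0//.
    by have := uw j; rewrite /u; lra.
  by rewrite LS; move: ltS; rewrite mulrBl mul1r; lra.
exists (fun j => s * `|L j| + e); split.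
- by move=> j; rewrite ltr_wpDl// mulr_ge0// ltW.
- rewrite big_split/= -mulr_sumr lerD// sumr_const card_ord /e -[_ *+ N]mulr_natl.
  by rewrite ler_pdivrMr// mul1r ler_nat.
- move=> g g1.
  (* Fg carries an additive error e.  Once g is normalized to have maximum 1,
     attained at j1, the extra weight e at j1 absorbs this error; undoing the
     normalization costs nothing because a <= s. *)
  have [g0|] := pselect (forall j, g j = 0).
    have -> : g = 0 by apply/funext => j; exact: g0.
    rewrite (seminorm0 sF) powR0 ?gt_eqF//; apply: sumr_ge0 => j _.
    by rewrite mulr_ge0 ?powR_ge0 ?addr_ge0 ?mulr_ge0 ?(ltW s0) ?(ltW e0).
  move=> /existsNP[j0 /eqP gj0].
  have [j1 _ j1max] := @arg_maxP _ _ _ j0 xpredT (fun j => `|g j|) erefl.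
  pose M := `|g j1|.
  have gM j : `|g j| <= M by exact: j1max.
  have M0 : 0 < M by apply: lt_le_trans (gM j0); rewrite normr_gt0.
  have M1 : M <= 1 by exact: g1.
  pose g' := M^-1 *: g.
  have gE : g = M *: g' by rewrite /g' scalerA mulfV ?gt_eqF// scale1r.
  have ng' j : `|g' j| = M^-1 * `|g j|.
    by rewrite /g' scale_funE normrM ger0_norm// invr_ge0 ltW.
  have g'1 j : `|g' j| <= 1 by rewrite ng' ler_pdivrMl// mulr1 gM.
  have Fg' : F g' `^ s <= \sum_j (s * `|L j| + e) * `|g' j| `^ a.
    apply: le_trans (Fg _ g'1) _.
    under [leRHS]eq_bigr do rewrite mulrDl -mulrA.
    rewrite big_split /= -mulr_sumr addrC lerD2r (bigD1 j1)//= ng' mulVf ?gt_eqF//.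
    rewrite powR1 mulr1 lerDl; apply: sumr_ge0 => j _.
    by rewrite mulr_ge0 ?powR_ge0// ltW.
  have FgE : F g = M * F g' by rewrite [in LHS]gE FZ (ger0_norm (ltW M0)).
  have ng j : `|g j| = M * `|g' j| by rewrite ng' mulrA mulfV ?gt_eqF// mul1r.
  rewrite FgE powRM ?(ltW M0)//.
  apply: (@le_trans _ _ (M `^ a * F g' `^ s)).
    by rewrite ler_wpM2r ?powR_ge0// ger_powR// M0 M1.
  apply: le_trans (ler_wpM2l (powR_ge0 _ _) Fg') _.
  rewrite mulr_sumr; apply: ler_sum => j _.
  by rewrite mulrCA ng powRM ?(ltW M0).
Qed.

(** * From weighted small powers to weighted large powers *)

Lemma geometric_sum_le (R : realType) (x : R) m : 0 <= x < 1 ->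
  \sum_(k < m) x ^+ k <= (1 - x)^-1.
Proof.
move=> /andP[x0 x1].
have x10 : 0 < 1 - x by rewrite subr_gt0.
rewrite -[leRHS]mul1r ler_pdivlMr// mulrC.
have := subrX1 x m; rewrite -opprB -(opprB 1 x) mulNr => /oppr_inj <-.
by rewrite lerBlDr lerDl exprn_ge0.
Qed.

(** Cut [g] at the levels [2 ^ m].  The part of [g] of size about [2 ^ m] lives
    on a set of weight at most [2 ^ (- m t)], so [F] is at most
    [2 * 2 ^ m * 2 ^ (- m t / s)] there, and these bounds are summable because
    [s < t].  The part of [g] below [1] contributes [L ^ (1 / s)]. *)
Lemma dyadic_bound (R : realType) N (F : ('I_N -> R) -> R) (lam : 'I_N -> R) (s t L : R) :
  seminorm F -> 1 <= s -> s < t -> (forall j, 0 <= lam j) -> \sum_j lam j <= L ->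
  (forall g, (forall j, `|g j| <= 1) -> F g `^ s <= \sum_j lam j * `|g j|) ->
  forall g, \sum_j lam j * `|g j| `^ t <= 1 ->
    F g <= L `^ s^-1 + 2 / (1 - 2 `^ (1 - t / s)).
Proof.
move=> sF s1 st lam0 lamL Fs g gt1; have [FD FZ] := sF; have F0 := seminorm_ge0 sF.
have s0 : 0 < s by lra.
have t0 : 0 < t by lra.
pose rho : R := 2 `^ (1 - t / s).
have rho0 : 0 <= rho by exact: powR_ge0.
have rho1 : rho < 1.
  rewrite /rho -[ltRHS](powRr0 2) /powR pnatr_eq0/= ltr_expR ltr_pM2r ?ln_gt0 ?ltr1n//.
  by rewrite subr_lt0 ltr_pdivlMr// mul1r.
have le1 h : (forall j, `|h j| <= 1) -> F h <= (\sum_j lam j * `|h j|) `^ s^-1.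
  move=> h1; rewrite -[F h]powRr1// -(mulfV (lt0r_neq0 s0)) powRrM.
  apply: ge0_ler_powR; rewrite ?nnegrE ?invr_ge0 ?(ltW s0) ?powR_ge0//; last exact: Fs.
  by apply: sumr_ge0 => j _; rewrite mulr_ge0.
have main m : forall g, \sum_j lam j * `|g j| `^ t <= 1 ->
    (forall j, `|g j| <= 2 ^+ m) -> F g <= L `^ s^-1 + 2 * \sum_(k < m) rho ^+ k.
  elim: m => [|m IH] {gt1}g gt1 gm.
    rewrite big_ord0 mulr0 addr0; apply: le_trans (le1 _ gm) _.
    apply: ge0_ler_powR; rewrite ?nnegrE ?invr_ge0 ?(ltW s0)//.
    - by apply: sumr_ge0 => j _; rewrite mulr_ge0.
    - by apply: le_trans lamL; apply: sumr_ge0.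
    - apply: le_trans lamL; apply: ler_sum => j _.
      by rewrite ler_piMr//; exact: gm.
  pose g1 j := if `|g j| <= 2 ^+ m then g j else 0.
  pose g2 j := if `|g j| <= 2 ^+ m then 0 else g j.
  have -> : g = g1 + g2.
    apply/funext => j; rewrite /g1 /g2 /GRing.add/=.
    by case: ifP; rewrite ?addr0 ?add0r.
  apply: le_trans (FD _ _) _; rewrite big_ord_recr/= mulrDr addrA; apply: lerD.
    apply: IH => [|j]; last by rewrite /g1; case: ifP => // _; rewrite normr0 exprn_ge0.
    apply: le_trans gt1; apply: ler_sum => j _; rewrite /g1; case: ifP => // _.
    by rewrite normr0 powR0 ?gt_eqF// mulr0 mulr_ge0 ?powR_ge0.
  pose h := (2 ^+ m.+1)^-1 *: g2.
  have p0 k : 0 < 2 ^+ k :> R by rewrite exprn_gt0.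
  have -> : g2 = 2 ^+ m.+1 *: h by rewrite /h scalerA mulfV ?gt_eqF// scale1r.
  have nh j : `|h j| = (2 ^+ m.+1)^-1 * `|g2 j|.
    by rewrite /h scale_funE normrM ger0_norm// invr_ge0 ltW.
  have h1 j : `|h j| <= 1.
    rewrite nh ler_pdivrMl// mulr1 /g2; case: ifP => // _.
    by rewrite normr0 ltW.
  rewrite FZ (ger0_norm (ltW (p0 _))) exprS -mulrA ler_pM2l//.
  have -> : rho ^+ m = 2 ^+ m * (((2 ^+ m) `^ (- t)) `^ s^-1).
    rewrite -(powR_mulrn _ rho0) -(@powR_mulrn _ 2 m)// -!powRrM -powRD.
      by congr (_ `^ _); ring.
    by rewrite pnatr_eq0 implybT.
  rewrite ler_pM2l//; apply: le_trans (le1 _ h1) _.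
  apply: ge0_ler_powR; rewrite ?nnegrE ?invr_ge0 ?(ltW s0) ?powR_ge0//.
    by apply: sumr_ge0 => j _; rewrite mulr_ge0.
  (* Markov: the total weight of the points where |g| > 2 ^ m *)
  rewrite powRN -[leRHS]mul1r ler_pdivlMr ?powR_gt0// mulr_suml.
  apply: le_trans gt1; apply: ler_sum => j _; rewrite -mulrA ler_wpM2l//.
  rewrite nh /g2; have [_|gj] := leP `|g j| (2 ^+ m); first by rewrite normr0 mulr0 mul0r powR_ge0.
  apply: (@le_trans _ _ (1 * (2 ^+ m) `^ t)).
    by rewrite ler_wpM2r ?powR_ge0// ler_pdivrMl// mulr1.
  by rewrite mul1r; apply: ge0_ler_powR; rewrite ?nnegrE ?(ltW t0) ?(ltW gj) ?(ltW (p0 _)).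
have [m gm] : exists m, forall j, `|g j| <= 2 ^+ m.
  exists (Num.truncn (\sum_j `|g j|)).+1 => j.
  apply: (@le_trans _ _ (\sum_j `|g j|)).
    by rewrite (bigD1 j)//= lerDl sumr_ge0.
  apply: ltW; apply: lt_le_trans (truncnS_gt _) _.
  by rewrite -natrX ler_nat ltnW// ltn_expl.
apply: le_trans (main m g gt1 gm) _; rewrite lerD2l ler_pM2l//.
by apply: geometric_sum_le; rewrite rho0.
Qed.

(** * Rademacher averages *)

Lemma rademacher_flip (R : realType) m (i : 'I_m) (G : {ffun 'I_m -> bool} -> R) :
  \sum_(eps : {ffun 'I_m -> bool}) G eps =
  \sum_(eps : {ffun 'I_m -> bool}) G [ffun j => (j == i) (+) eps j].
Proof.
rewrite [LHS](reindex_inj (h := fun eps : {ffun 'I_m -> bool} => [ffun j => (j == i) (+) eps j]))//.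
apply: (can_inj (g := fun eps : {ffun 'I_m -> bool} => [ffun j => (j == i) (+) eps j])).
by move=> e; apply/ffunP => j; rewrite !ffunE addbA addbb.
Qed.

(** Khintchine's inequality for the fourth moment, by induction on the number
    of signs: flipping one sign preserves the average, so the odd powers of the
    new term cancel, and the second moments give the cross term. *)
Lemma rademacher_moments (R : realType) m (a : 'I_m -> R) (l : seq 'I_m) : uniq l ->
  \sum_(eps : {ffun 'I_m -> bool}) (\sum_(i <- l) (-1) ^+ eps i * a i) ^+ 2 =
    2 ^+ m * \sum_(i <- l) a i ^+ 2 /\
  \sum_(eps : {ffun 'I_m -> bool}) (\sum_(i <- l) (-1) ^+ eps i * a i) ^+ 4 <=
    2 ^+ m * (3 * (\sum_(i <- l) a i ^+ 2) ^+ 2).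
Proof.
elim: l => [_|i l IH /= /andP[il /IH[IH2 IH4]]].
  under eq_bigr do rewrite big_nil expr0n.
  under [X in _ /\ X <= _]eq_bigr do rewrite big_nil expr0n.
  by rewrite big_nil big1// expr0n !mulr0.
pose S (eps : {ffun 'I_m -> bool}) := \sum_(i <- l) (-1) ^+ eps i * a i.
have flipS (eps : {ffun 'I_m -> bool}) : S [ffun j => (j == i) (+) eps j] = S eps.
  rewrite /S !big_seq; apply: eq_bigr => j jl; rewrite ffunE.
  by have [ji|] := eqVneq j i; [rewrite ji (negbTE il) in jl|].
(* average over the sign at i, on which S does not depend *)
have even (H : R -> R) : \sum_(eps : {ffun 'I_m -> bool}) H ((-1) ^+ eps i * a i + S eps) =
    \sum_(eps : {ffun 'I_m -> bool}) ((H (S eps + a i) + H (S eps - a i)) / 2).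
  have E0 : \sum_(eps : {ffun 'I_m -> bool}) H ((-1) ^+ eps i * a i + S eps) =
            \sum_(eps : {ffun 'I_m -> bool}) H (- ((-1) ^+ eps i * a i) + S eps).
    rewrite (rademacher_flip i); apply: eq_bigr => eps _.
    rewrite flipS ffunE eqxx /=; case: (eps i) => /=.
      by rewrite expr0 expr1 mulN1r opprK mul1r.
    by rewrite expr0 expr1 mulN1r mul1r.
  rewrite -[LHS](@mulfK _ 2) ?pnatr_eq0// mulr_natr mulr2n {2}E0 -big_split/= mulr_suml.
  apply: eq_bigr => eps _; case: (eps i); rewrite ?expr1 ?expr0 ?mulN1r ?mul1r ?opprK //.
    by rewrite addrC ![_ + S eps]addrC.
  by rewrite ![_ + S eps]addrC.
under eq_bigr do rewrite big_cons -/(S _).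
under [X in _ /\ X <= _]eq_bigr do rewrite big_cons -/(S _).
rewrite (even (fun x => x ^+ 2)) (even (fun x => x ^+ 4)).
have card : \sum_(eps : {ffun 'I_m -> bool}) 1 = 2 ^+ m :> R.
  by rewrite sumr_const card_ffun card_bool card_ord natrX.
rewrite big_cons; move: IH2 IH4; rewrite -/(S _).
set A := \sum_(j <- l) _ => IH2 IH4; split.
  under eq_bigr => eps _.
    have -> : ((S eps + a i) ^+ 2 + (S eps - a i) ^+ 2) / 2 = S eps ^+ 2 + a i ^+ 2 * 1 by field.
    over.
  by rewrite big_split/= -mulr_sumr card IH2; ring.
under eq_bigr => eps _.
  have -> : ((S eps + a i) ^+ 4 + (S eps - a i) ^+ 4) / 2 =
     S eps ^+ 4 + ((6 * a i ^+ 2) * S eps ^+ 2 + a i ^+ 4 * 1) by field.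
  over.
rewrite !big_split/= -!mulr_sumr card IH2.
apply: le_trans (lerD IH4 (lexx _)) _.
have : 0 <= 2 ^+ m * a i ^+ 4 by apply: mulr_ge0; [exact: exprn_ge0|exact: exprn_even_ge0].
rewrite -subr_ge0 => H; rewrite -subr_ge0.
have -> : 2 ^+ m * (3 * (a i ^+ 2 + A) ^+ 2) -
  (2 ^+ m * (3 * A ^+ 2) + (6 * a i ^+ 2 * (2 ^+ m * A) + a i ^+ 4 * 2 ^+ m)) =
  2 * (2 ^+ m * a i ^+ 4 - 0) by ring.
by rewrite mulr_ge0.
Qed.

(** * Weights for a seminorm of finite cotype *)

Definition seminorm_cotype (R : realType) (V : lmodType R) (F : V -> R) (s C : R) :=
  forall m (f : 'I_m -> V),
    (\sum_j F (f j) `^ s) `^ s^-1 <=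
    C * Num.sqrt ((2 ^+ m)^-1 * \sum_(eps : {ffun 'I_m -> bool})
                    F (\sum_j (-1) ^+ eps j *: f j) ^+ 2).

Lemma cotype_average (R : realType) (V : lmodType R) (F : V -> R) (s C B : R) m
    (f : 'I_m -> V) :
  0 < s -> 0 <= C -> seminorm_cotype F s C ->
  \sum_(eps : {ffun 'I_m -> bool}) F (\sum_j (-1) ^+ eps j *: f j) ^+ 2 <= 2 ^+ m * B ->
  \sum_j F (f j) `^ s <= (C * Num.sqrt B) `^ s.
Proof.
move=> s0 C0 cF FB.
have S0 : 0 <= \sum_j F (f j) `^ s by apply: sumr_ge0 => j _; exact: powR_ge0.
rewrite -[leLHS]powRr1// -(mulVf (lt0r_neq0 s0)) powRrM.
apply: ge0_ler_powR; rewrite ?nnegrE ?powR_ge0 ?(ltW s0) ?mulr_ge0 ?sqrtr_ge0//.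
apply: le_trans (cF m f) _; rewrite ler_wpM2l// ler_wsqrtr//.
by rewrite ler_pdivrMl// exprn_gt0.
Qed.

Lemma sum_fun_apply (R : realType) N m (c : 'I_m -> R) (f : 'I_m -> 'I_N -> R) j :
  (\sum_i c i *: f i) j = \sum_i c i * f i j.
Proof. by rewrite fct_sumE. Qed.

(** If the [|f i|] add up to at most [1] at every point, then every signed sum
    of the [f i] lies in the unit ball of the supremum norm, so their Rademacher
    average is at most [1]. *)
Lemma cotype_summing (R : realType) N (F : ('I_N -> R) -> R) (s C : R) :
  seminorm F -> 0 < s -> 0 <= C -> seminorm_cotype F s C ->
  (forall g, (forall j, `|g j| <= 1) -> F g <= 1) ->
  forall m (f : 'I_m -> 'I_N -> R), (forall j, \sum_i `|f i j| `^ 1 <= 1) ->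
     \sum_i F (f i) `^ s <= C `^ s.
Proof.
move=> sF s0 C0 cF F1 m f f1.
rewrite -[C in leRHS]mulr1 -[X in C * X]sqrtr1; apply: cotype_average => //.
apply: (@le_trans _ _ (\sum_(eps : {ffun 'I_m -> bool}) 1)).
  apply: ler_sum => eps _; rewrite expr_le1// ?(seminorm_ge0 sF)//.
  apply: F1 => j; rewrite sum_fun_apply; apply: le_trans (ler_norm_sum _ _ _) _.
  apply: le_trans (f1 j); apply: ler_sum => i _.
  by rewrite normrM normrX normrN1 expr1n mul1r powRr1.
by rewrite sumr_const card_ffun card_bool card_ord natrX mulr1.
Qed.

(** Cotype [s] makes [F] summing of type [(s, 1)], which gives weights
    controlling [F g ^ s] by the weighted sum of [|g|] on the unit ball; the
    dyadic decomposition then controls [F] by the weighted [l_t] norm. *)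
Lemma cotype_weights_gt (R : realType) (s t C : R) :
  1 <= s -> s < t -> 0 <= C ->
  exists2 C' : R, 0 <= C' & forall N (F : ('I_N -> R) -> R),
    seminorm F -> seminorm_cotype F s C ->
    (forall g, (forall j, `|g j| <= 1) -> F g <= 1) ->
    exists lam : 'I_N -> R, [/\ forall j, 0 < lam j, \sum_j lam j <= C' &
      forall g, F g `^ t <= C' * \sum_j lam j * `|g j| `^ t].
Proof.
move=> s1 st C0.
have s0 : 0 < s by lra.
have t0 : 0 < t by lra.
pose L := s * C `^ s + 1; pose D := L `^ s^-1 + 2 / (1 - 2 `^ (1 - t / s)).
have L0 : 0 <= L by rewrite addr_ge0// mulr_ge0 ?powR_ge0 ?ltW.
exists (L + D `^ t); first by rewrite addr_ge0 ?powR_ge0.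
move=> N F sF cF F1.
have [lam [lam0 lamL lamF]] :=
  pietsch_weights sF (lexx 1) s1 (cotype_summing sF s0 C0 cF F1).
exists lam; split=> // [|g]; first by apply: le_trans lamL _; rewrite lerDl powR_ge0.
have FD : forall g, \sum_j lam j * `|g j| `^ t <= 1 -> F g <= D.
  apply: (dyadic_bound sF s1 st _ lamL) => [j|h h1]; first exact: ltW.
  by apply: le_trans (lamF _ h1) _; under eq_bigr do rewrite powRr1//.
have [FS FZ] := sF.
set Q := \sum_j lam j * `|g j| `^ t.
have Q0 : 0 <= Q by apply: sumr_ge0 => j _; rewrite mulr_ge0 ?powR_ge0 ?ltW.
apply: (@le_trans _ _ (D `^ t * Q)); last by rewrite ler_wpM2r// lerDr.
move: (Q0); rewrite le_eqVlt => /predU1P[Q00|Qp].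
  have g0 : g = 0.
    apply/funext => j; apply/eqP; rewrite -normr_eq0; apply/eqP.
    have /eqP := Q00; rewrite eq_sym psumr_eq0; last first.
      by move=> i _; rewrite mulr_ge0 ?powR_ge0 ?ltW.
    move=> /allP/(_ j (mem_index_enum _))/=.
    by rewrite mulf_eq0 gt_eqF//= => /eqP/powR_eq0_eq0.
  by rewrite -Q00 mulr0 g0 (seminorm0 sF) powR0// gt_eqF.
pose tau := Q `^ t^-1.
have tau0 : 0 < tau by exact: powR_gt0.
have taut : tau `^ t = Q by rewrite -powRrM mulVf ?gt_eqF// powRr1.
have := FD (tau^-1 *: g); rewrite FZ normfV (gtr0_norm tau0).
under eq_bigr => j _.
  rewrite scale_funE normrM normfV (gtr0_norm tau0) powRM ?invr_ge0 ?(ltW tau0)//.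
  rewrite mulrCA; over.
rewrite -mulr_sumr -/Q -powR_inv1 ?(ltW tau0)// powRAC taut powR_inv1//.
rewrite mulVf ?gt_eqF// => /(_ (lexx 1)); rewrite powR_inv1 ?(ltW tau0)//.
rewrite ler_pdivrMl// => H.
have D0 : 0 <= D.
  by rewrite -(pmulr_rge0 _ tau0); apply: le_trans H; exact: seminorm_ge0.
rewrite mulrC -taut -powRM ?(ltW tau0)//.
by apply: ge0_ler_powR; rewrite ?nnegrE ?(ltW t0) ?(seminorm_ge0 sF) ?mulr_ge0 ?(ltW tau0).
Qed.

(** The endpoint exponent for cotype 2.  Domination by a weighted [l_4] norm is
    already known; combined with the fourth moment inequality it shows that the
    Rademacher average of the [f i] is bounded as soon as the squares of the
    [f i] add up to at most [1] at every point.  So [F] is 2-summing, and the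
    extremal argument applies again with both exponents equal to [2]. *)
Lemma cotype2_weights (R : realType) (C : R) : 0 <= C ->
  exists2 C' : R, 0 <= C' & forall N (F : ('I_N -> R) -> R),
    seminorm F -> seminorm_cotype F 2 C ->
    (forall g, (forall j, `|g j| <= 1) -> F g <= 1) ->
    exists lam : 'I_N -> R, [/\ forall j, 0 < lam j, \sum_j lam j <= C' &
      forall g, F g `^ 2 <= C' * \sum_j lam j * `|g j| `^ 2].
Proof.
move=> C0.
have [C4 C40 C4P] := @cotype_weights_gt R 2 4 C ltac:(lra) ltac:(lra) C0.
pose B := 1 + 3 * C4 ^+ 2; pose K := (C * Num.sqrt B) `^ 2.
have K0 : 0 <= 2 * K + 1 by rewrite addr_ge0// mulr_ge0// powR_ge0.
exists (2 * K + 1) => //.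
move=> N F sF cF F1; have [FS FZ] := sF.
have [lam4 [lam40 lam4L lam4F]] := C4P N F sF cF F1.
have [|lam [lam0 lamL lamF]] := @pietsch_weights R N F 2 2 K sF ltac:(lra) (lexx _).
  move=> m f f1; apply: cotype_average => //.
  apply: (@le_trans _ _ (\sum_(eps : {ffun 'I_m -> bool}) (1 + C4 * \sum_j lam4 j *
      (\sum_i (-1) ^+ eps i * f i j) ^+ 4))).
    apply: ler_sum => eps _; set h := \sum_i _.
    have := lam4F h; rewrite (@powR_mulrn _ _ 4) ?(seminorm_ge0 sF)//.
    have -> : \sum_j lam4 j * `|h j| `^ 4 =
        \sum_j lam4 j * (\sum_i (-1) ^+ eps i * f i j) ^+ 4.
      apply: eq_bigr => j _; rewrite (@powR_mulrn _ _ 4)// /h sum_fun_apply.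
      by rewrite -normrX ger0_norm// exprn_even_ge0.
    move=> H; apply: (@le_trans _ _ (1 + F h ^+ 4)); last by rewrite lerD2l.
    (* x <= 1 + x ^ 2 replaces the comparison of second and fourth moments *)
    rewrite (exprM _ 2 2); set x := F h ^+ 2.
    have := sqr_ge0 (x - 1); have : 0 <= x by exact: sqr_ge0.
    rewrite sqrrB1; lra.
  rewrite big_split/= sumr_const card_ffun card_bool card_ord natrX -mulr_sumr.
  rewrite exchange_big/= /B mulrDr mulr1 lerD2l.
  rewrite (_ : 2 ^+ m * (3 * C4 ^+ 2) = C4 * (C4 * (3 * 2 ^+ m))); last by ring.
  rewrite ler_wpM2l//.
  apply: (@le_trans _ _ (\sum_j lam4 j * (3 * 2 ^+ m))); last first.
    by rewrite -mulr_suml ler_wpM2r// mulr_ge0// exprn_ge0.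
  apply: ler_sum => j _; rewrite -mulr_sumr ler_wpM2l ?(ltW (lam40 _))//.
  have [_] := rademacher_moments (fun i => f i j) (index_enum_uniq 'I_m).
  move=> /le_trans; apply; rewrite mulrC ler_wpM2r ?exprn_ge0//.
  rewrite ler_piMr// expr_le1//; last by apply: sumr_ge0 => i _; exact: sqr_ge0.
  apply: le_trans (f1 j); apply: ler_sum => i _.
  by rewrite (@powR_mulrn _ _ 2)// real_normK// num_real.
exists lam; split=> // g.
have sum0 : 0 <= \sum_j lam j * `|g j| `^ 2.
  by apply: sumr_ge0 => j _; rewrite mulr_ge0 ?powR_ge0// ltW.
apply: (@le_trans _ _ (\sum_j lam j * `|g j| `^ 2)); last first.
  by rewrite ler_peMl// lerDr mulr_ge0// powR_ge0.
pose M := 1 + \sum_j `|g j|.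
have M0 : 0 < M by rewrite ltr_wpDr// sumr_ge0.
have := lamF (M^-1 *: g); rewrite FZ normfV (gtr0_norm M0).
rewrite powRM ?invr_ge0 ?(seminorm_ge0 sF) ?(ltW M0)//.
under eq_bigr => j _.
  rewrite scale_funE normrM normfV (gtr0_norm M0) powRM ?invr_ge0 ?(ltW M0)//.
  rewrite mulrCA; over.
rewrite -mulr_sumr ler_pM2l ?powR_gt0 ?invr_gt0//; apply => j.
rewrite scale_funE normrM normfV (gtr0_norm M0) ler_pdivrMl// mulr1 /M.
by rewrite (bigD1 j)//= addrCA lerDl addr_ge0// sumr_ge0.
Qed.

(** * Real scalars inside the scalar field *)

Section Scalars.
Context {R : realType} {b : scalar_kind}.
Local Notation K := (scalars R b).

Definition of_real : R -> K :=
  match b return R -> scalars R b with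
  | RealScalars => fun x => x
  | ComplexScalars => fun x => real_complex R x
  end.

Definition im_scalar : K -> R :=
  match b return scalars R b -> R with
  | RealScalars => fun=> 0
  | ComplexScalars => fun z => complex.Im z
  end.

Lemma of_realD x y : of_real (x + y) = of_real x + of_real y.
Proof. by rewrite /of_real; case: b => //=; rewrite rmorphD. Qed.

Lemma of_realM x y : of_real (x * y) = of_real x * of_real y.
Proof. by rewrite /of_real; case: b => //=; rewrite rmorphM. Qed.

Lemma of_realN x : of_real (- x) = - of_real x.
Proof. by rewrite /of_real; case: b => //=; rewrite rmorphN. Qed.

Lemma of_real1 : of_real 1 = 1.
Proof. by rewrite /of_real; case: b. Qed.

Lemma of_real0 : of_real 0 = 0.
Proof. by rewrite /of_real; case: b. Qed.

Lemma re_of_real x : re_scalar (of_real x) = x.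
Proof. by rewrite /re_scalar /of_real; case: b. Qed.

Lemma re_scalarD x y : re_scalar (x + y : K) = re_scalar x + re_scalar y.
Proof. by move: x y; rewrite /re_scalar; case: b => //= -[? ?] [? ?]. Qed.

Lemma re_scalarZ t x : re_scalar (of_real t * x : K) = t * re_scalar x.
Proof.
move: x; rewrite /re_scalar /of_real; case: b => //= -[? ?] /=.
by rewrite mul0r subr0.
Qed.

Lemma im_scalarD x y : im_scalar (x + y : K) = im_scalar x + im_scalar y.
Proof. by move: x y; rewrite /im_scalar; case: b => [? ?|[? ?] [? ?]]//=; rewrite addr0. Qed.

Lemma im_scalarZ t x : im_scalar (of_real t * x : K) = t * im_scalar x.
Proof.
move: x; rewrite /im_scalar /of_real; case: b => [?|[? ?]] /=; first by rewrite mulr0.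
by rewrite mul0r addr0.
Qed.

Lemma ge0_of_real_re (z : K) : 0 <= z -> of_real (re_scalar z) = z.
Proof.
move: z; rewrite /re_scalar /of_real; case: b => //= -[x y].
by rewrite lecE/= => /andP[/eqP -> _].
Qed.

Lemma of_real_le x y : (of_real x <= of_real y) = (x <= y).
Proof. by rewrite /of_real; case: b => //=; rewrite lecR. Qed.

Lemma re_scalar_le (x y : K) : x <= y -> re_scalar x <= re_scalar y.
Proof.
move: x y; rewrite /re_scalar; case: b => //= -[? ?] [? ?].
by rewrite lecE/= => /andP[].
Qed.

Lemma norm_of_real x : `|of_real x| = of_real `|x|.
Proof. by rewrite /of_real; case: b => //=; rewrite normc_def/= expr0n/= addr0 sqrtr_sqr. Qed.

Lemma re_le_norm (z : K) : `|re_scalar z| <= re_scalar `|z|.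
Proof.
move: z; rewrite /re_scalar; case: b => //= -[x y] /=.
by rewrite -sqrtr_sqr ler_wsqrtr// lerDl sqr_ge0.
Qed.

Lemma im_le_norm (z : K) : `|im_scalar z| <= re_scalar `|z|.
Proof.
move: z; rewrite /re_scalar /im_scalar; case: b => [x|[x y]] /=; first by rewrite normr0.
by rewrite -sqrtr_sqr ler_wsqrtr// lerDr sqr_ge0.
Qed.

Lemma norm_le_re_im (z : K) : re_scalar `|z| <= `|re_scalar z| + `|im_scalar z|.
Proof.
move: z; rewrite /re_scalar /im_scalar; case: b => [x|[x y]] /=.
  by rewrite normr0 addr0.
rewrite -[leRHS]ger0_norm ?addr_ge0// -[leRHS]sqrtr_sqr ler_wsqrtr//.
rewrite sqrrD !real_normK ?num_real// addrAC lerDl mulrn_wge0// mulr_ge0.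
Qed.

Section Rnorm.
Context (V : normedModType K).
Implicit Types x y : V.

Lemma of_real_rnorm x : of_real (rnorm x) = `|x|.
Proof. exact: ge0_of_real_re. Qed.

Lemma rnorm_ge0 x : 0 <= rnorm x.
Proof. by rewrite -of_real_le of_real_rnorm of_real0. Qed.

Lemma rnormD x y : rnorm (x + y) <= rnorm x + rnorm y.
Proof. by rewrite -re_scalarD; apply: re_scalar_le; exact: ler_normD. Qed.

Lemma rnormZ (a : K) x : rnorm (a *: x) = re_scalar `|a| * rnorm x.
Proof. by rewrite /rnorm normrZ -[`|a|]ge0_of_real_re// re_scalarZ re_of_real. Qed.

Lemma rnormZr t x : rnorm (of_real t *: x) = `|t| * rnorm x.
Proof. by rewrite rnormZ norm_of_real re_of_real. Qed.

Lemma rnorm0 : rnorm (0 : V) = 0.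
Proof. by rewrite /rnorm normr0 -[0 in LHS]of_real0 re_of_real. Qed.

Lemma rnorm_eq0 x : rnorm x = 0 -> x = 0.
Proof. by move=> x0; apply/eqP; rewrite -normr_eq0 -of_real_rnorm x0 of_real0. Qed.

End Rnorm.
End Scalars.

(** A copy of the type [X], on which the real numbers act through [of_real]
    whichever the scalar field is. *)
Definition realified (R : realType) (b : scalar_kind) (X : lmodType (scalars R b)) : Type := X.

Section Realified.
Context (R : realType) (b : scalar_kind) (X : lmodType (scalars R b)).
HB.instance Definition _ := GRing.Zmodule.on (realified X).
Definition real_scale (t : R) (x : realified X) : realified X :=
  of_real t *: (x : X).
Lemma real_scaleA t u x : real_scale t (real_scale u x) = real_scale (t * u) x.
Proof. by rewrite /real_scale of_realM scalerA. Qed.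
Lemma real_scale1 : left_id 1 real_scale.
Proof. by move=> x; rewrite /real_scale of_real1 scale1r. Qed.
Lemma real_scaleDr : right_distributive real_scale +%R.
Proof. by move=> t x y; rewrite /real_scale scalerDr. Qed.
Lemma real_scaleDl x : {morph real_scale^~ x : t u / t + u}.
Proof. by move=> t u; rewrite /real_scale of_realD scalerDl. Qed.
HB.instance Definition _ := GRing.Zmodule_isLmodule.Build R (realified X)
  real_scaleA real_scale1 real_scaleDr real_scaleDl.
End Realified.

(** * Norming functionals and weakly summable sequences *)

(** In the complex case [phi x = q x - i q (i x)]. *)
Lemma scalar_of_real_part (R : realType) (b : scalar_kind)
    (X : lmodType (scalars R b)) (q : X -> R) :
  (forall x y, q (x + y) = q x + q y) ->
  (forall t x, q (of_real t *: x) = t * q x) ->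
  exists phi : X -> (scalars R b)^o, scalar phi /\ forall x, re_scalar (phi x) = q x.
Proof.
case: b X q => X q qD qZ.
  by exists q; split=> // a x y; rewrite qD -qZ.
pose i : R[i] := Complex 0 1.
exists (fun x => Complex (q x) (- q (i *: x))); split=> // -[c d] x y.
have aE : Complex c d = of_real (b := ComplexScalars) c + of_real (b := ComplexScalars) d * i.
  by rewrite /of_real /i /=; simpc.
have ia : i * Complex c d = of_real (b := ComplexScalars) c * i + of_real (b := ComplexScalars) (- d).
  by rewrite /of_real /i /=; simpc.
have qa : q (Complex c d *: x) = c * q x + d * q (i *: x).
  by rewrite aE scalerDl -scalerA qD !qZ.
have qia : q (i *: (Complex c d *: x)) = c * q (i *: x) - d * q x.
  by rewrite scalerA ia scalerDl -scalerA qD !qZ mulNr.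
rewrite scalerDr !qD qa qia /=; simpc; congr (Complex _ _); ring.
Qed.

Section Duality.
Context {R : realType} {b : scalar_kind}.
Local Notation K := (scalars R b).
Context (X : normedModType K).

Lemma scalar_fun0 (phi : X -> K^o) : scalar phi -> phi 0 = 0.
Proof. by move=> lphi; have := lphi (-1) 0 0; rewrite scaler0 addr0 mulN1r addNr. Qed.

Lemma scalar_funZ (phi : X -> K^o) a x : scalar phi -> phi (a *: x) = a * phi x.
Proof. by move=> lphi; have := lphi a x 0; rewrite !addr0 (scalar_fun0 lphi) addr0. Qed.

Lemma contraction_continuous (phi : X -> K^o) :
  scalar phi -> (forall x, `|phi x| <= `|x|) -> continuous phi.
Proof.
move=> lphi phi1.
pose f : {linear X -> K^o} := HB.pack phi (GRing.isLinear.Build _ _ _ _ phi lphi).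
apply: (@bounded_linear_continuous _ _ _ f); apply/linear_boundedP.
exists 1; split; first exact: real1.
move=> r r1 x; apply: le_trans (phi1 x) _.
by rewrite ler_peMl// ltW.
Qed.

Lemma norming_functional (x0 : X) :
  exists2 phi : X -> K^o, dual_unit_ball phi & rnorm x0 <= rnorm (phi x0).
Proof.
have [|q [qD qZ qle qx0]] := @hahn_banach_sublinear R (realified X) (@rnorm R b X) x0.
  split=> [x y|t x t0]; first exact: rnormD.
  by rewrite rnormZr ger0_norm.
have [phi [lphi phiq]] := scalar_of_real_part qD qZ.
have le1 x : rnorm (phi x) <= rnorm x.
  have [z0|z0] := eqVneq (phi x) 0.
    by rewrite z0 (rnorm0 K^o) rnorm_ge0.
  (* rotate x so that phi takes a nonnegative value there *)
  pose u : K := `|phi x| / phi x.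
  have nu : `|u| = 1 by rewrite /u normrM normr_id normfV mulfV ?normr_eq0.
  have <- : rnorm (u *: x) = rnorm x.
    by rewrite rnormZ nu -of_real1 re_of_real mul1r.
  apply: le_trans (qle (u *: x)); by rewrite -phiq (scalar_funZ _ _ lphi) /u mulfVK.
exists phi; last by rewrite -qx0 -phiq; apply: le_trans (ler_norm _) (re_le_norm _).
split=> // [|x]; last exact: le_trans.
apply: contraction_continuous => // x.
by have := le1 x; rewrite -(of_real_le (b := b)) !of_real_rnorm.
Qed.

Lemma dual_unit_ball_le (phi : X -> K^o) x :
  dual_unit_ball phi -> rnorm (phi x) <= rnorm x.
Proof.
move=> [lphi _ phi1].
have [x0|x0] := eqVneq (rnorm x) 0.
  by rewrite (rnorm_eq0 x0) (scalar_fun0 lphi) (rnorm0 K^o) rnorm_ge0.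
have xp : 0 < rnorm x by rewrite lt_neqAle eq_sym x0 rnorm_ge0.
have := phi1 (of_real (rnorm x)^-1 *: x).
rewrite (scalar_funZ _ _ lphi).
have -> : rnorm (of_real (rnorm x)^-1 * phi x : K^o) = (rnorm x)^-1 * rnorm (phi x).
  by rewrite [LHS](rnormZr (V := K^o)) ger0_norm// invr_ge0 ltW.
rewrite rnormZr normfV (gtr0_norm xp) mulVf// => /(_ (lexx _)).
by rewrite ler_pdivrMl// mulr1.
Qed.

Definition weak_bound (q W : R) (x : nat -> X) := forall phi, dual_unit_ball phi ->
  forall N, \sum_(0 <= j < N) rnorm (phi (x j)) `^ q <= W.

Lemma weakly_summableP (q : R) (x : nat -> X) :
  weakly_summable q x <-> exists W, weak_bound q W x.
Proof.
have ge0 phi j : true -> (0 <= (rnorm (phi (x j) : K^o) `^ q)%:E)%E.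
  by rewrite lee_fin powR_ge0.
split=> [wx|[W xW]]; last first.
  apply: (@le_lt_trans _ _ W%:E); last exact: ltry.
  apply: ge_ereal_sup => _ [phi Bphi <-].
  apply: lime_le; first by apply: is_cvg_nneseries => n _; exact: ge0.
  by apply: nearW => N; rewrite sumEFin lee_fin; exact: xW.
have zB : dual_unit_ball (fun=> 0 : K^o).
  split=> [a y z||y _]; first by rewrite mulr0 addr0.
    exact: cst_continuous.
  by rewrite (rnorm0 K^o) ler01.
exists (fine (ereal_sup [set (\sum_(0 <= j <oo) (rnorm (phi (x j)) `^ q)%:E)%E
             | phi in @dual_unit_ball R b X])) => phi Bphi N.
have le1 : (\sum_(0 <= j <oo) (rnorm (phi (x j)) `^ q)%:E <=
    ereal_sup [set (\sum_(0 <= j <oo) (rnorm (phi (x j)) `^ q)%:E)%E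
             | phi in @dual_unit_ball R b X])%E.
  by apply: ereal_sup_ubound; exists phi.
have le2 : ((\sum_(0 <= j < N) rnorm (phi (x j)) `^ q)%:E <=
   \sum_(0 <= j <oo) (rnorm (phi (x j)) `^ q)%:E)%E.
  by rewrite -sumEFin; apply: nneseries_lim_ge => n _; exact: ge0.
rewrite -lee_fin fineK; first exact: le_trans le1.
rewrite ge0_fin_numE//; apply: le_trans le1; apply: nneseries_ge0 => n _; exact: ge0.
Qed.

Lemma strongly_summableP (p : R) (x : nat -> X) :
  strongly_summable p x <-> exists W, forall N, \sum_(0 <= j < N) rnorm (x j) `^ p <= W.
Proof.
have ge0 j : true -> (0 <= (rnorm (x j) `^ p)%:E)%E by rewrite lee_fin powR_ge0.
split=> [sx|[W xW]]; last first.
  apply: (@le_lt_trans _ _ W%:E); last exact: ltry.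
  apply: lime_le; first by apply: is_cvg_nneseries => n _; exact: ge0.
  by apply: nearW => N; rewrite sumEFin lee_fin; exact: xW.
exists (fine (\sum_(0 <= j <oo) (rnorm (x j) `^ p)%:E)%E) => N.
rewrite -lee_fin fineK -?sumEFin; first by apply: nneseries_lim_ge => n _; exact: ge0.
rewrite ge0_fin_numE//; apply: nneseries_ge0 => n _; exact: ge0.
Qed.

Lemma weakly_summable_le (q q' : R) (x : nat -> X) :
  0 < q -> q <= q' -> weakly_summable q x -> weakly_summable q' x.
Proof.
move=> q0 qq' /weakly_summableP[W xW]; apply/weakly_summableP.
exists (W * W `^ ((q' - q) / q)) => phi Bphi N.
apply: (@le_trans _ _ (\sum_(0 <= j < N) rnorm (phi (x j)) `^ q * W `^ ((q' - q) / q))).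
  apply: ler_sum => j _.
  have le1 : rnorm (phi (x j)) `^ q <= W.
    apply: le_trans (xW _ Bphi j.+1); rewrite big_nat_recr//= lerDr.
    by apply: sumr_ge0 => i _; exact: powR_ge0.
  have W0 : 0 <= W by apply: le_trans le1; exact: powR_ge0.
  rewrite -{1}(subrK q q') addrC powRD; last by apply/implyP => /eqP; lra.
  rewrite ler_wpM2l ?powR_ge0//.
  have -> : rnorm (phi (x j)) `^ (q' - q) =
            (rnorm (phi (x j)) `^ q) `^ ((q' - q) / q).
    by rewrite -powRrM mulrC divfK ?gt_eqF.
  by apply: ge0_ler_powR; rewrite ?nnegrE ?powR_ge0 ?divr_ge0 ?subr_ge0// ltW.
by rewrite -mulr_suml ler_wpM2r ?powR_ge0//; exact: xW.
Qed.

End Duality.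

(** * Rescaling a finite weakly summable sequence *)

(** [p < s / (s - 1)] means that [s] is smaller than the exponent
    [p / (p - 1)] conjugate to [p]; this exponent is [2] when [p = 2]. *)
Lemma cotype_weights (R : realType) (s p C : R) :
  2 <= s -> 1 < p -> p < s / (s - 1) \/ s = 2 /\ p = 2 -> 0 <= C ->
  exists2 C' : R, 0 <= C' & forall N (F : ('I_N -> R) -> R),
    seminorm F -> seminorm_cotype F s C ->
    (forall g, (forall j, `|g j| <= 1) -> F g <= 1) ->
    exists lam : 'I_N -> R, [/\ forall j, 0 < lam j, \sum_j lam j <= C' &
      forall g, F g `^ (p / (p - 1)) <= C' * \sum_j lam j * `|g j| `^ (p / (p - 1))].
Proof.
move=> s2 p1 [ps|[-> ->]] C0; last first.
  have -> : 2 / (2 - 1) = 2 :> R by field.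
  exact: cotype2_weights.
apply: cotype_weights_gt => //; first lra.
have p10 : 0 < p - 1 by lra.
have s10 : 0 < s - 1 by lra.
by rewrite ltr_pdivlMr//; move: ps; rewrite ltr_pdivlMr//; lra.
Qed.

(** Duality between [l_p] and [l_t], [t = p / (p - 1)]: test the bound on [F]
    against [g = sgn d * lam ^ (1 - p) * |d| ^ (p - 1)].  For this [g], both the
    pairing with [d] and the weighted sum of [|g| ^ t] are equal to the sum [D]
    to be estimated, so that [D ^ t <= C * D]. *)
Lemma dual_weighted_sum (R : realType) N (F : ('I_N -> R) -> R) (lam d : 'I_N -> R) (p C : R) :
  1 < p -> 0 <= C -> (forall j, 0 < lam j) ->
  (forall g, F g `^ (p / (p - 1)) <= C * \sum_j lam j * `|g j| `^ (p / (p - 1))) ->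
  (forall g, \sum_j g j * d j <= F g) ->
  \sum_j lam j `^ (1 - p) * `|d j| `^ p <= C `^ (p - 1).
Proof.
move=> p1 C0 lam0 Fle dF.
have p10 : 0 < p - 1 by lra.
have p0 : 0 < p by lra.
pose t := p / (p - 1); have t0 : 0 < t by rewrite divr_gt0.
pose g j := Num.sg (d j) * (lam j `^ (1 - p) * `|d j| `^ (p - 1)).
set D := \sum_j _.
have D0 : 0 <= D by apply: sumr_ge0 => j _; rewrite mulr_ge0 ?powR_ge0.
have gd : \sum_j g j * d j = D.
  apply: eq_bigr => j _; rewrite /g -(mulr_powRB1 (normr_ge0 _) p0).
  by rewrite [X in _ = _ * (X * _)]normrEsg; ring.
have gt j : lam j * `|g j| `^ t = lam j `^ (1 - p) * `|d j| `^ p.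
  have [d0|d0] := eqVneq (d j) 0.
    by rewrite /g d0 sgr0 mul0r normr0 !powR0 ?gt_eqF// !mulr0.
  rewrite /g normrM normr_sg d0 mul1r ger0_norm ?mulr_ge0 ?powR_ge0//.
  rewrite powRM ?powR_ge0// -!powRrM mulrA.
  have -> : (p - 1) * t = p by rewrite /t; field; rewrite gt_eqF.
  congr (_ * _); rewrite -{1}[lam j]powRr1 ?(ltW (lam0 j))// -powRD; last first.
    by rewrite (gt_eqF (lam0 j)) implybT.
  by congr (_ `^ _); rewrite /t; field; rewrite gt_eqF.
have DC : D `^ t <= C * D.
  have := Fle g; rewrite -/t; under eq_bigr do rewrite gt.
  apply: le_trans; apply: ge0_ler_powR; rewrite ?nnegrE ?(ltW t0)//.
    by rewrite (le_trans D0)// -gd.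
  by rewrite -gd.
move: D0; rewrite le_eqVlt => /predU1P[<-|D0]; first exact: powR_ge0.
have : D `^ (t - 1) <= C.
  by rewrite -(ler_pM2l D0) mulr_powRB1 ?(ltW D0)// mulrC.
have -> : t - 1 = (p - 1)^-1 by rewrite /t; field; rewrite gt_eqF.
move=> H; have DE : D = (D `^ (p - 1)^-1) `^ (p - 1).
  by rewrite -powRrM mulVf ?gt_eqF// powRr1// ltW.
rewrite [leLHS]DE.
by apply: ge0_ler_powR; rewrite ?nnegrE ?powR_ge0 ?(ltW p10).
Qed.

(** Either [c j <= lam j], or [c j = c j ^ p * c j ^ (1 - p)] is at most
    [c j ^ p * lam j ^ (1 - p)]. *)
Lemma sum_le_weighted (R : realType) N (lam c : 'I_N -> R) (p : R) :
  1 <= p -> (forall j, 0 < lam j) -> (forall j, 0 <= c j) ->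
  \sum_j c j <= \sum_j lam j `^ (1 - p) * c j `^ p + \sum_j lam j.
Proof.
move=> p1 lam0 c0; rewrite -big_split; apply: ler_sum => j _ /=.
have [cl|lc] := leP (c j) (lam j); first by rewrite ler_wpDl// mulr_ge0 ?powR_ge0.
have cj0 : 0 < c j by exact: lt_trans lc.
rewrite ler_wpDr ?(ltW (lam0 _))//.
have p0 : 0 < p by lra.
rewrite -(mulr_powRB1 (ltW cj0) p0).
rewrite mulrCA ler_peMr ?(ltW cj0)// -opprB powRN mulrC ler_pdivlMr ?powR_gt0// mul1r.
by apply: ge0_ler_powR; rewrite ?nnegrE ?(ltW cj0) ?(ltW (lam0 _)) ?(ltW lc) ?subr_ge0.
Qed.

Lemma powR_add_le (R : realType) (x y p : R) : 0 <= x -> 0 <= y -> 0 <= p ->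
  (x + y) `^ p <= 2 `^ p * (x `^ p + y `^ p).
Proof.
wlog xy : x y / x <= y => [H x0 y0 p0|x0 y0 p0].
  by have [xy|/ltW yx] := leP x y; [exact: H|rewrite addrC [X in _ * X]addrC; exact: H].
apply: (@le_trans _ _ ((2 * y) `^ p)).
  by apply: ge0_ler_powR; rewrite ?nnegrE ?addr_ge0 ?mulr_ge0//; lra.
by rewrite powRM// ler_wpM2l ?powR_ge0// lerDr powR_ge0.
Qed.

Section FiniteSequences.
Context {R : realType} {b : scalar_kind}.
Local Notation K := (scalars R b).
Context (X : normedModType K).

Definition real_comb N (x : 'I_N -> X) (g : 'I_N -> R) : X :=
  \sum_i of_real (g i) *: x i.

Lemma real_combD N (x : 'I_N -> X) g h :
  real_comb x (g + h) = real_comb x g + real_comb x h.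
Proof.
by rewrite -big_split; apply: eq_bigr => i _ /=; rewrite -scalerDl -of_realD.
Qed.

Lemma real_combZ N (x : 'I_N -> X) t g :
  real_comb x (t *: g) = of_real t *: real_comb x g.
Proof.
by rewrite scaler_sumr; apply: eq_bigr => i _ /=; rewrite scalerA -of_realM.
Qed.

Lemma real_comb_sum N (x : 'I_N -> X) m (c : 'I_m -> R) (f : 'I_m -> 'I_N -> R) :
  real_comb x (\sum_j c j *: f j) = \sum_j of_real (c j) *: real_comb x (f j).
Proof.
have comb0 : real_comb x 0 = 0.
  by rewrite /real_comb big1// => i _; rewrite of_real0 scale0r.
rewrite (big_morph _ (real_combD x) comb0).
by apply: eq_bigr => j _; exact: real_combZ.
Qed.

Lemma seminorm_real_comb N (x : 'I_N -> X) : seminorm (fun g => rnorm (real_comb x g)).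
Proof.
split=> [g h|t g]; first by rewrite real_combD rnormD.
by rewrite real_combZ rnormZr.
Qed.

Lemma of_real_sign k : of_real ((-1) ^+ k) = (-1) ^+ k :> K.
Proof.
elim: k => [|k IH]; first by rewrite !expr0 of_real1.
by rewrite !exprS of_realM IH of_realN of_real1.
Qed.

Lemma has_cotype_real_comb (s : R) : has_cotype X s ->
  exists2 C : R, 0 <= C & forall N (x : 'I_N -> X),
    seminorm_cotype (fun g => rnorm (real_comb x g)) s C.
Proof.
move=> [C cX]; exists `|C| => // N x m f.
apply: le_trans (cX m (fun j => real_comb x (f j))) _.
apply: (@le_trans _ _ (`|C| * Num.sqrt ((2 ^+ m)^-1 * \sum_(eps : {ffun 'I_m -> bool})
             rnorm (\sum_(j < m) (-1) ^+ eps j *: real_comb x (f j)) ^+ 2))).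
  by rewrite ler_wpM2r ?sqrtr_ge0// ler_norm.
rewrite le_eqVlt; apply/orP; left; apply/eqP; congr (_ * Num.sqrt (_ * _)).
apply: eq_bigr => eps _; rewrite real_comb_sum.
by under [in RHS]eq_bigr do rewrite of_real_sign.
Qed.

Lemma dual_real_comb N (x : 'I_N -> X) g (phi : X -> K^o) : dual_unit_ball phi ->
  phi (real_comb x g) = \sum_i of_real (g i) * phi (x i).
Proof.
move=> [lphi _ _].
have phiD y z : phi (y + z) = phi y + phi z.
  by have := lphi 1 y z; rewrite scale1r mul1r.
rewrite (big_morph _ phiD (scalar_fun0 lphi)); apply: eq_bigr => i _.
exact: scalar_funZ.
Qed.

Lemma rnorm_real_comb_le N (x : 'I_N -> X) (B : R) :
  (forall phi, dual_unit_ball phi -> \sum_i rnorm (phi (x i) : K^o) <= B) ->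
  forall g, (forall i, `|g i| <= 1) -> rnorm (real_comb x g) <= B.
Proof.
move=> xB g g1; have [phi Bphi le1] := norming_functional (real_comb x g).
apply: le_trans le1 _; rewrite dual_real_comb//; apply: le_trans (xB _ Bphi).
apply: (@le_trans _ _ (\sum_i rnorm (of_real (g i) *: (phi (x i) : K^o)))).
  apply: (big_ind2 (fun (y : K^o) u => rnorm y <= u)).
  - by rewrite (rnorm0 K^o).
  - by move=> y u z v yu zv; apply: le_trans (rnormD _ _) _; exact: lerD.
  - by [].
by apply: ler_sum => i _; rewrite rnormZr ler_piMl ?rnorm_ge0.
Qed.

(** [dual_weighted_sum] is a statement about real sequences; it is applied to
    the real and to the imaginary part of [phi (x j)]. *)
Lemma dual_sum_le N (x : 'I_N -> X) (lam : 'I_N -> R) (p C : R) :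
  1 < p -> 0 <= C -> (forall j, 0 < lam j) ->
  (forall g, rnorm (real_comb x g) `^ (p / (p - 1)) <=
             C * \sum_j lam j * `|g j| `^ (p / (p - 1))) ->
  forall phi, dual_unit_ball phi ->
    \sum_j lam j `^ (1 - p) * rnorm (phi (x j) : K^o) `^ p <= 2 `^ p * (2 * C `^ (p - 1)).
Proof.
move=> p1 C0 lam0 xle phi Bphi.
have re_le : \sum_j lam j `^ (1 - p) * `|re_scalar (phi (x j))| `^ p <= C `^ (p - 1).
  apply: (dual_weighted_sum p1 C0 lam0 xle) => g.
  apply: le_trans (dual_unit_ball_le _ Bphi); rewrite dual_real_comb//.
  apply: le_trans (le_trans (ler_norm _) (re_le_norm _)).
  have re0 : re_scalar (0 : K) = 0 by rewrite -(@of_real0 R b) re_of_real.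
  rewrite (big_morph _ (@re_scalarD R b) re0).
  by apply: ler_sum => i _; rewrite re_scalarZ.
have im_le : \sum_j lam j `^ (1 - p) * `|im_scalar (phi (x j))| `^ p <= C `^ (p - 1).
  apply: (dual_weighted_sum p1 C0 lam0 xle) => g.
  apply: le_trans (dual_unit_ball_le _ Bphi); rewrite dual_real_comb//.
  apply: le_trans (le_trans (ler_norm _) (im_le_norm _)).
  have im0 : im_scalar (0 : K) = 0.
    by have := @im_scalarZ R b 0 0; rewrite mulr0 mul0r.
  rewrite (big_morph _ (@im_scalarD R b) im0).
  by apply: ler_sum => i _; rewrite im_scalarZ.
rewrite mulr_natl mulr2n; apply: le_trans (ler_wpM2l (powR_ge0 _ _) (lerD re_le im_le)).
rewrite -big_split/= mulr_sumr; apply: ler_sum => j _.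
rewrite -mulrDr mulrCA ler_wpM2l ?powR_ge0//.
apply: le_trans (powR_add_le _ _ _); rewrite ?normr_ge0//; last lra.
apply: ge0_ler_powR; rewrite ?nnegrE ?rnorm_ge0 ?addr_ge0//; first lra.
exact: norm_le_re_im.
Qed.

(** For [r = 1] this is the factorization of a weakly 1-summable sequence given
    by the weights [lam] of the seminorm [g |-> |sum_i g i x i|]:
    the vectors [lam i ^ (1 / p - 1) x i] are weakly p-summable.  For
    general [r], the vectors [a i * x i], with [a i] proportional to
    [c i ^ (r - 1)], are weakly 1-summable by Young's inequality, and pairing
    [a] with [c] recovers the [l_r] norm of [c].  The constant does not
    depend on the number of vectors, which is what the gluing requires. *)
Lemma rescale_weakly_summable_fin (s p r W : R) :
  2 <= s -> has_cotype X s -> 1 <= r -> r < p ->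
  p < s / (s - 1) \/ s = 2 /\ p = 2 -> 0 <= W ->
  exists2 C : R, 0 < C & forall N (x : 'I_N -> X) (c : 'I_N -> R),
    (forall phi, dual_unit_ball phi -> \sum_i rnorm (phi (x i) : K^o) `^ r <= W) ->
    (forall i, 0 <= c i) ->
    exists beta : 'I_N -> R, [/\ forall i, 0 <= beta i,
      forall phi, dual_unit_ball phi ->
        \sum_i beta i * rnorm (phi (x i) : K^o) `^ p <= C &
      (\sum_i c i `^ r) `^ r^-1 <= C * (\sum_i beta i * c i `^ p + 1)].
Proof.
move=> s2 cX r1 rp ps W0.
have p1 : 1 < p by lra.
have r0 : 0 < r by lra.
have [C0 C00 C0P] := has_cotype_real_comb cX.
have [L L0 LP] := cotype_weights s2 p1 ps C00.
pose A : R := 2 `^ p * (2 * L `^ (p - 1)).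
have A0 : 0 <= A by rewrite !mulr_ge0 ?powR_ge0.
have W1 : 0 < 1 + W by lra.
pose C := A + (1 + W) * (1 + L).
have WL0 : 0 < (1 + W) * (1 + L) by rewrite mulr_gt0//; lra.
exists C; first by rewrite /C; lra.
move=> N x c xW c0; set S := \sum_i c i `^ r.
have : 0 <= S by apply: sumr_ge0 => i _; exact: powR_ge0.
rewrite le_eqVlt => /predU1P[S0|S0].
  exists (fun=> 0); split=> // [phi _|].
    by rewrite big1 => [|i _]; rewrite /C ?mul0r//; lra.
  rewrite -S0 powR0 ?invr_neq0 ?gt_eqF// mulr_ge0//; first by rewrite /C; lra.
  by rewrite big1 ?add0r// => i _; rewrite mul0r.
pose sigma := S `^ r^-1.
have sigma0 : 0 < sigma by exact: powR_gt0.
have sigmar : sigma `^ r = S by rewrite -powRrM mulVf ?gt_eqF// powRr1// ltW.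
(* c' is c normalized in l_r *)
pose c' i := c i / sigma.
have c'0 i : 0 <= c' i by rewrite divr_ge0// ltW.
have sumc' : \sum_i c' i `^ r = 1.
  under eq_bigr => i _.
    rewrite powRM ?invr_ge0 ?(ltW sigma0)// -powR_inv1 ?(ltW sigma0)// powRAC sigmar.
    rewrite powR_inv1 ?(ltW S0)//; over.
  by rewrite -mulr_suml mulfV ?gt_eqF.
pose a i := c' i `^ (r - 1) / (1 + W).
have a0 i : 0 <= a i by rewrite divr_ge0 ?powR_ge0 ?(ltW W1).
have sumac : \sum_i a i * c i = sigma / (1 + W).
  under eq_bigr => i _.
    have -> : a i * c i = c' i `^ r * (sigma / (1 + W)).
      rewrite -mulr_powRB1// /a.
      have -> : c i = c' i * sigma by rewrite /c' divfK ?gt_eqF.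
      ring.
    over.
  by rewrite -mulr_suml sumc' mul1r.
pose x' i := of_real (a i) *: x i.
have phix' phi i : dual_unit_ball phi ->
    rnorm (phi (x' i) : K^o) = a i * rnorm (phi (x i) : K^o).
  move=> [lphi _ _]; rewrite (scalar_funZ _ _ lphi).
  by rewrite [LHS](rnormZr (V := K^o)) ger0_norm.
have x'1 : forall g, (forall i, `|g i| <= 1) -> rnorm (real_comb x' g) <= 1.
  apply: rnorm_real_comb_le => phi Bphi; under eq_bigr do rewrite phix'//.
  under eq_bigr do rewrite /a mulrAC.
  rewrite -mulr_suml ler_pdivrMr// mul1r -(ler_pM2l r0).
  apply: (@le_trans _ _ ((r - 1) * 1 + W)); last by rewrite mulr1 mulrDr; nra.
  rewrite -[X in _ * X + _]sumc' !mulr_sumr; apply: le_trans (lerD (lexx _) (xW _ Bphi)).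
  rewrite -big_split; apply: ler_sum => i _.
  exact: young_tangent r1 (c'0 i) (rnorm_ge0 _).
have [lam [lam0 lamL lamF]] := LP N _ (seminorm_real_comb x') (C0P N x') x'1.
exists (fun i => lam i `^ (1 - p) * a i `^ p); split=> [i|phi Bphi|].
- by rewrite mulr_ge0 ?powR_ge0.
- apply: (@le_trans _ _ A); last by rewrite /C; lra.
  apply: le_trans (dual_sum_le p1 L0 lam0 lamF Bphi); apply: ler_sum => i _.
  by rewrite -mulrA phix'// powRM ?rnorm_ge0.
- have := @sum_le_weighted R N lam (fun i => a i * c i) p (ltW p1) lam0 (fun i => mulr_ge0 (a0 i) (c0 i)).
  rewrite sumac -/sigma.
  under [X in _ <= X + _ -> _]eq_bigr do rewrite powRM// mulrA.
  set D := \sum_i _ * c i `^ p; rewrite ler_pdivrMr// => H.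
  have D0 : 0 <= D by apply: sumr_ge0 => i _; rewrite !mulr_ge0 ?powR_ge0.
  apply: le_trans H _; apply: (@le_trans _ _ ((1 + W) * (1 + L) * (D + 1))).
    by rewrite mulrC -mulrA ler_pM2l//; nra.
  by rewrite ler_wpM2r ?lerDr//; lra.
Qed.

End FiniteSequences.

(** * Gluing finite rescalings *)

Lemma sum_window_le (R : realType) (a : nat -> R) m n N : (forall j, 0 <= a j) ->
  \sum_(0 <= j < N) (if (m <= j < n)%N then a j else 0) <= \sum_(m <= j < n) a j.
Proof.
move=> a0; rewrite -big_mkcond/=.
rewrite (big_nat_widenl m 0)// (big_nat_widen 0 n (maxn N n)) ?leq_maxr//.
rewrite (big_nat_widen 0 N (maxn N n)) ?leq_maxl//.
rewrite [leLHS]big_mkcond [leRHS]big_mkcond; apply: ler_sum => j _ /=.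
by case: (m <= j)%N; case: (j < n)%N; case: (j < N)%N => /=; rewrite ?lexx ?a0.
Qed.

Lemma sum_window (R : realType) (a : nat -> R) m n :
  \sum_(0 <= j < n) (if (m <= j < n)%N then a j else 0) = \sum_(m <= j < n) a j.
Proof.
rewrite -big_mkcond/= (big_nat_widenl m 0)// big_nat_cond [RHS]big_nat_cond.
by apply: eq_bigl => j; case: (m <= j)%N; case: (j < n)%N.
Qed.

(** Weights that are good on the windows [m <= j < n m] are added with the
    factors [2 ^ (- m)]: this keeps the upper bounds, while the lower bounds
    [4 ^ m] still give [2 ^ m].  Since the [m]-th window starts at [m], only
    finitely many windows contain a given index, whatever their overlaps. *)
Lemma glue_weights (R : realType) (D : set (nat -> R)) (e : nat -> R) (C : R) :
  (forall d, D d -> forall j, 0 <= d j) -> (forall j, 0 <= e j) -> 0 <= C ->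
  (forall m, exists n, exists beta : nat -> R, [/\ forall j, 0 <= beta j,
     forall d, D d -> \sum_(m <= j < n) beta j * d j <= C &
     4 ^+ m <= \sum_(m <= j < n) beta j * e j]) ->
  exists beta : nat -> R, [/\ forall j, 0 <= beta j,
    forall d, D d -> forall N, \sum_(0 <= j < N) beta j * d j <= 2 * C &
    forall W, exists N, W < \sum_(0 <= j < N) beta j * e j].
Proof.
move=> D0 e0 C0 /choice[n /choice[bt H]].
have bt0 m j : 0 <= bt m j by have [] := H m.
have btD m d : D d -> \sum_(m <= j < n m) bt m j * d j <= C by have [_ + _] := H m; apply.
have bte m : 4 ^+ m <= \sum_(m <= j < n m) bt m j * e j by have [] := H m.
pose w m j : R := if (m <= j < n m)%N then bt m j else 0.
have w0 m j : 0 <= w m j by rewrite /w; case: ifP.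
have wM m j (u : R) : w m j * u = if (m <= j < n m)%N then bt m j * u else 0.
  by rewrite /w; case: ifP => // _; rewrite mul0r.
have h0 m : 0 <= 2^-1 ^+ m :> R by rewrite exprn_ge0.
pose beta j := \sum_(0 <= m < j.+1) 2^-1 ^+ m * w m j.
have wbeta m j : 2^-1 ^+ m * w m j <= beta j.
  have bj0 : 0 <= beta j by apply: sumr_ge0 => i _; rewrite mulr_ge0.
  have [mj|jm] := leqP m j; last by rewrite /w leqNgt jm /= mulr0.
  rewrite /beta big_mkord (bigD1 (Ordinal (mj : (m < j.+1)%N)))//= lerDl.
  by apply: sumr_ge0 => i _; rewrite mulr_ge0.
exists beta; split=> [j|d Dd N|W].
- by apply: sumr_ge0 => i _; rewrite mulr_ge0.
- apply: (@le_trans _ _ (\sum_(0 <= j < N) \sum_(0 <= m < N) 2^-1 ^+ m * (w m j * d j))).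
    rewrite big_nat [leRHS]big_nat; apply: ler_sum => j /andP[_ jN].
    rewrite [leRHS](big_cat_nat (n := j.+1))//= mulr_suml.
    rewrite ler_wpDr//; first by apply: sumr_ge0 => m _; rewrite mulr_ge0 ?mulr_ge0 ?(D0 _ Dd).
    by apply: ler_sum => m _; rewrite mulrA.
  rewrite exchange_big_nat/=.
  apply: (@le_trans _ _ (\sum_(0 <= m < N) 2^-1 ^+ m * C)).
    apply: ler_sum => m _; rewrite -mulr_sumr ler_wpM2l//.
    apply: le_trans (btD m d Dd).
    under eq_bigr do rewrite wM.
    by apply: sum_window_le => j; rewrite mulr_ge0 ?(D0 _ Dd).
  rewrite -mulr_suml ler_wpM2r// big_mkord.
  apply: le_trans (geometric_sum_le _ _) _; first by lra.
  by rewrite le_eqVlt; apply/orP; left; apply/eqP; field.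
- pose m := (Num.truncn `|W|).+1; exists (n m).
  apply: (@lt_le_trans _ _ (2 ^+ m)).
    apply: le_lt_trans (ler_norm _) _; apply: lt_le_trans (truncnS_gt _) _.
    by rewrite -natrX ler_nat ltnW// ltn_expl.
  apply: (@le_trans _ _ (\sum_(0 <= j < n m) 2^-1 ^+ m * (w m j * e j))); last first.
    by apply: ler_sum => j _; rewrite mulrA ler_wpM2r.
  rewrite -mulr_sumr; under eq_bigr do rewrite wM.
  rewrite sum_window; apply: le_trans (ler_wpM2l (h0 m) (bte m)).
  by rewrite -exprMn (_ : 2^-1 * 4 = 2)//; field.
Qed.

(** * Summing operators *)

Section Rescaling.
Context {R : realType} {b : scalar_kind}.
Local Notation K := (scalars R b).
Context (X : normedModType K).

(** If [c] is not in [l_r], then on the window starting at [m] the finite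
    rescaling applies with a right end [n] so large that the [l_r] norm of [c]
    on the window exceeds [C * (4 ^ m + 1)]; the rescalings are then glued. *)
Lemma rescale_weakly_summable (s p r : R) (x : nat -> X) (c : nat -> R) :
  2 <= s -> has_cotype X s -> 1 <= r -> r < p ->
  p < s / (s - 1) \/ s = 2 /\ p = 2 ->
  weakly_summable r x -> (forall j, 0 <= c j) ->
  (forall W, exists N, W < \sum_(0 <= j < N) c j `^ r) ->
  exists a : nat -> R, [/\ forall j, 0 <= a j,
    weakly_summable p (fun j => of_real (a j) *: x j) &
    forall W, exists N, W < \sum_(0 <= j < N) (a j * c j) `^ p].
Proof.
move=> s2 cX r1 rp ps /weakly_summableP[W0 xW0] c0 cdiv.
have p0 : 0 < p by lra.
have r0 : 0 < r by lra.
pose W := Num.max 0 W0.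
have W_ge0 : 0 <= W by rewrite le_max lexx.
have [C C0 CP] := rescale_weakly_summable_fin s2 cX r1 rp ps W_ge0.
pose D : set (nat -> R) := [set (fun j => rnorm (phi (x j) : K^o) `^ p) | phi in @dual_unit_ball R b X].
have D0 d : D d -> forall j, 0 <= d j by move=> [phi _ <-] j; exact: powR_ge0.
have [|beta [beta0 betaD betac]] :=
    @glue_weights R D (fun j => c j `^ p) C D0 (fun j => powR_ge0 _ _) (ltW C0).
  move=> m.
  pose big := (C * (4 ^+ m + 1)) `^ r.
  have [n ltn] := cdiv (\sum_(0 <= j < m) c j `^ r + big).
  have mn : (m <= n)%N.
    rewrite leqNgt; apply/negP => nm; move: ltn; apply/negP; rewrite -leNgt.
    rewrite (big_cat_nat (n := n) _ (ltnW nm))//= -addrA lerDl addr_ge0 ?powR_ge0//.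
    by apply: sumr_ge0 => j _; exact: powR_ge0.
  have {}ltn : big < \sum_(m <= j < n) c j `^ r.
    by move: ltn; rewrite [X in _ < X](big_cat_nat (n := m))//= ltrD2l.
  have shift (G : nat -> R) : \sum_(m <= j < n) G j = \sum_(i < n - m) G (i + m)%N.
    by rewrite -{1}[m]add0n big_addn big_mkord.
  have [||beta [beta0 betaC betac]] :=
      CP (n - m)%N (fun i => x (i + m)%N) (fun i => c (i + m)%N) => //.
    move=> phi Bphi; rewrite -(shift (fun j => rnorm (phi (x j) : K^o) `^ r)).
    apply: (@le_trans _ _ W0); last by rewrite le_max lexx orbT.
    apply: le_trans (xW0 phi Bphi n); rewrite [leRHS](big_cat_nat (n := m))//= lerDr.
    by apply: sumr_ge0 => j _; exact: powR_ge0.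
  pose beta' j := if insub (j - m)%N is Some i then beta i else 0.
  have beta'E (i : 'I_(n - m)) : beta' (i + m)%N = beta i.
    by rewrite /beta' addnK valK.
  exists n, beta'; split=> [j|d [phi Bphi <-]|].
  - by rewrite /beta'; case: insub.
  - rewrite shift; under eq_bigr do rewrite beta'E.
    exact: betaC.
  - rewrite shift; under eq_bigr do rewrite beta'E.
    move: betac; rewrite -(shift (fun j => c j `^ r)) => betac.
    rewrite -(lerD2r 1) -(ler_pM2l C0); apply: le_trans betac.
    have big0 : 0 <= C * (4 ^+ m + 1) by rewrite mulr_ge0 ?(ltW C0)// addr_ge0// exprn_ge0.
    have -> : C * (4 ^+ m + 1) = big `^ r^-1 by rewrite -powRrM mulfV ?gt_eqF// powRr1.
    apply: ge0_ler_powR; rewrite ?nnegrE ?invr_ge0 ?(ltW r0) ?powR_ge0 ?(ltW ltn)//.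
    by apply: sumr_ge0 => j _; exact: powR_ge0.
have ap j : (beta j `^ p^-1) `^ p = beta j by rewrite -powRrM mulVf ?gt_eqF// powRr1.
exists (fun j => beta j `^ p^-1); split=> [j||V].
- exact: powR_ge0.
- apply/weakly_summableP; exists (2 * C) => phi Bphi N.
  apply: le_trans (betaD _ (imageP _ Bphi) N); apply: ler_sum => j _.
  have [lphi _ _] := Bphi; rewrite (scalar_funZ _ _ lphi).
  rewrite [X in X `^ p](rnormZr (V := K^o)) ger0_norm ?powR_ge0//.
  by rewrite powRM ?powR_ge0 ?rnorm_ge0// ap.
- have [N VN] := betac V; exists N; under eq_bigr do rewrite powRM ?powR_ge0// ap.
  exact: VN.
Qed.

End Rescaling.

(** If the norms [c j] of the values of [T] were not in [l_r], the sequence in the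
    coordinate [i0] could be rescaled by numbers [a j] to a weakly p-summable
    one for which the new norms [a j * c j] are not in [l_p].  The other
    coordinates are unchanged: there, weak summability passes to larger
    exponents. *)
Lemma summing_inclusion (R : realType) (b : scalar_kind) n
    (X : 'I_n -> completeNormedModType (scalars R b))
    (Y : completeNormedModType (scalars R b))
    (i0 : 'I_n) (s p r : R) (q q' : 'I_n -> R) :
  2 <= s -> has_cotype (X i0) s -> 1 <= r -> r < p ->
  p < s / (s - 1) \/ s = 2 /\ p = 2 ->
  q i0 = p -> q' i0 = r -> (forall i, 0 < q' i <= q i) ->
  @summing R b n X Y p q `<=` @summing R b n X Y r q'.
Proof.
move=> s2 cX r1 rp ps qp q'r qq' T [cT sT]; split=> // x xw.
have p0 : 0 < p by lra.
pose c j := rnorm (T (fun i => x i j)).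
apply/strongly_summableP; apply: contrapT => /forallNP Hc.
have cdiv W : exists N, W < \sum_(0 <= j < N) c j `^ r.
  by have /existsNP[N /negP] := Hc W; rewrite -ltNge; exists N.
have c0 j : 0 <= c j by exact: rnorm_ge0.
have xw0 : weakly_summable r (x i0) by rewrite -q'r; exact: xw.
have [a [a0 aw adiv]] := rescale_weakly_summable s2 cX r1 rp ps xw0 c0 cdiv.
pose y i j : X i := dfwith (fun i => x i j) i0 (of_real (a j) *: x i0 j) i.
have Ty j : T (fun i => y i j) = of_real (a j) *: T (fun i => x i j).
  have [mT _] := cT; have lT := mT i0 (fun i => x i j).
  have T0 : T (dfwith (fun i => x i j) i0 0) = 0.
    have := lT (-1) 0 0; rewrite scaler0 addr0 scaleN1r => TE.
    by rewrite TE addNr.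
  have := lT (of_real (a j)) (x i0 j) 0; rewrite addr0 T0 addr0 => TE.
  rewrite /y TE; congr (_ *: T _); apply: functional_extensionality_dep => i.
  by case: dfwithP.
have [|W yW] := (strongly_summableP p (fun j => T (fun i => y i j))).1 _.
  apply: sT => i; have [->|ii0] := eqVneq i i0.
    rewrite qp (_ : y i0 = fun j => of_real (a j) *: x i0 j)//.
    by apply/funext => j; rewrite /y dfwithin.
  have [q'0 q'q] := andP (qq' i).
  rewrite (_ : y i = x i); first exact: weakly_summable_le q'q (xw i).
  by apply/funext => j; rewrite /y dfwithout// eq_sym.
have [N] := adiv W; apply/negP; rewrite -leNgt; apply: le_trans (yW N).
by apply: ler_sum => j _; rewrite Ty rnormZr ger0_norm.
Qed.

(** * The inclusion theorem *)

Theorem corollary2p4 (R : realType) (b : scalar_kind) (n k : nat)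
    (h2k : (2 <= k)%N) (hkn : (k <= n)%N)
    (q : R) (hq : 1 <= q)
    (X : 'I_n -> completeNormedModType (scalars R b))
    (Y : completeNormedModType (scalars R b))
    (s : 'I_n -> R)
    (hs2 : forall j : 'I_n, (j < k)%N -> 2 <= s j)
    (hcotype : forall j : 'I_n, (j < k)%N -> has_cotype (X j) (s j))
    (hsum : 1 <= \sum_(j < n | (j < k)%N) (s j)^-1)
    (p r : R) (hr : 1 <= r) (hrp : r < p)
    (hp_ne2 : (exists2 j : 'I_n, (j < k)%N & s j <> 2) ->
       (p%:E < \big[Order.min/+oo]_(j < n | (j < k)%N)
                 hoelder_conjugate (s j)%:E)%E)
    (hp_eq2 : (forall j : 'I_n, (j < k)%N -> s j = 2) -> p <= 2) :
  @summing R b n X Y p (fun i => if (i < k)%N then p else q) `<=`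
  @summing R b n X Y r (fun i => if (i < k)%N then r else q)
  /\
  @summing R b n X Y p (fun=> p) `<=` @summing R b n X Y r (fun=> r).
Proof.
(* a space whose exponent is not 2, if there is one: its conjugate exponent
   bounds p strictly; otherwise any of the first k spaces will do *)
have [i0 [i0k ps]] : exists i0 : 'I_n, (i0 < k)%N /\
    (p < s i0 / (s i0 - 1) \/ s i0 = 2 /\ p <= 2).
  have [[j jk sj2]|all2] := pselect (exists2 j : 'I_n, (j < k)%N & s j <> 2).
    exists j; split=> //; left.
    have sj := hs2 j jk.
    have := hp_ne2 (ex_intro2 _ _ j jk sj2).
    move=> /lt_le_trans/(_ (bigmin_le_cond _ (fun j => hoelder_conjugate (s j)%:E) jk)).
    rewrite /hoelder_conjugate /= eqe gt_eqF; last lra.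
    by rewrite -EFinB inver gt_eqF -?EFinM ?lte_fin//; lra.
  have n0 : (0 < n)%N by apply: leq_trans hkn; exact: leq_trans h2k.
  have s2 (j : 'I_n) : (j < k)%N -> s j = 2.
    by move=> jk; apply: contrapT => sj; apply: all2; exists j.
  exists (Ordinal n0); rewrite (leq_trans _ h2k)//; split=> //; right.
  by rewrite s2 ?(leq_trans _ h2k)//; split=> //; exact: hp_eq2.
have {}ps : p < s i0 / (s i0 - 1) \/ s i0 = 2 /\ p = 2.
  case: ps => [|[-> ]]; first by left.
  rewrite le_eqVlt => /predU1P[->|p2]; [by right|left].
  by rewrite (_ : 2 / (2 - 1) = 2)//; field.
have r0 : 0 < r by lra.
have q0 : 0 < q by lra.
split; apply: (summing_inclusion (hs2 _ i0k) (hcotype _ i0k) hr hrp ps);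
  rewrite ?i0k// => i; last by rewrite r0 ltW.
by case: ifP => _; rewrite ?r0 ?q0 ?lexx ?(ltW hrp).
Qed.
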